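(* Let $(M,\mathcal I,g)$ be a hyper-Hermitian manifold, with $\mathcal I$ generated by $I_1,I_2,I_3$, and for $a=1,2,3$ let $F_a(X,Y)=g(I_aX,Y)$ be the Kähler form of $(I_a,g)$. Then $(M,\mathcal I,g)$ is an HKT-structure if and only if $\partial_1(F_2+iF_3)=0$; equivalently, if and only if $\overline\partial_1(F_2-iF_3)=0$.
   Context: A hypercomplex structure $\mathcal I$ on a smooth manifold $M$ is given by three integrable complex structures $I_1,I_2,I_3$ with $I_1^2=I_2^2=I_3^2=-1$ and $I_1I_2=I_3=-I_2I_1$ (and consists of all $a_1I_1+a_2I_2+a_3I_3$ with $a_1^2+a_2^2+a_3^2=1$). A hyper-Hermitian manifold $(M,\mathcal I,g)$ is a hypercomplex manifold with a Riemannian metric $g$ such that $g(X,Y)=g(I_aX,I_aY)$ for $a=1,2,3$. A linear connection $\nabla$ on $(M,\mathcal I,g)$ is hyper-Hermitian if $\nabla g=0$ and $\nabla I_1=\nabla I_2=\nabla I_3=0$. It is hyper-Kähler (an HKT-connection) if moreover its torsion $T$ is totally skew-symmetric, i.e. $c(X,Y,Z)=g(X,T(Y,Z))$ is a 3-form. $(M,\mathcal I,g)$ is an HKT-structure if it admits an HKT-connection. For an $n$-form $\omega$ put $(I_1\omega)(X_1,\dots,X_n)=(-1)^n\omega(I_1X_1,\dots,I_1X_n)$ and $d_1\omega=(-1)^nI_1dI_1\omega$. Then $\partial_1=\frac12(d+id_1)$ and $\overline\partial_1=\frac12(d-id_1)$ are the usual $\partial$- and $\overline\partial$-operators of $I_1$.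 *)

(* Defs.v *)
From HB Require Import structures.
From mathcomp Require Import all_boot all_order all_algebra.
From mathcomp Require Import all_classical all_reals all_analysis.
From mathcomp Require Import complex.
Set Implicit Arguments.
Unset Strict Implicit.
Unset Printing Implicit Defensive.
Import Order.TTheory GRing.Theory Num.Theory.
Import numFieldNormedType.Exports.
Local Open Scope classical_set_scope.
Local Open Scope ring_scope.

Fixpoint Ck_on (R : realType) (V W : normedModType R) (U : set V) (k : nat)
    (f : V -> W) {struct k} : Prop :=
  match k with
  | 0%N => forall x, U x -> {for x, continuous f}
  | k'.+1 => (forall x, U x -> differentiable f x) /\
             (forall v : V, Ck_on U k' (fun x => 'D_v f x))
  end.

(* Only meant for open U. *)
Definition smooth_on (R : realType) (V W : normedModType R) (U : set V)
    (f : V -> W) : Prop :=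
  forall k, Ck_on U k f.

(* [chart a] maps the open set [chart_dom a] of the manifold homeomorphically
   onto the open set [chart_cod a] of R^n, with inverse [param a]; the values
   of these total functions outside those sets are irrelevant.  The atlas need
   not be maximal. *)
Record smoothManifold (R : realType) (n : nat) := SmoothManifold {
  points :> topologicalType ;
  points_hausdorff : hausdorff_space points ;
  points_second_countable : @second_countable points ;
  chart_index : Type ;
  chart_dom : chart_index -> set points ;
  chart_cod : chart_index -> set 'cV[R]_n ;
  chart : chart_index -> points -> 'cV[R]_n ;
  param : chart_index -> 'cV[R]_n -> points ;
  chart_dom_open : forall a, open (chart_dom a) ;
  chart_cod_open : forall a, open (chart_cod a) ;
  chart_cover : forall p, exists a, chart_dom a p ;
  chart_in : forall a p, chart_dom a p -> chart_cod a (chart a p) ;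
  param_in : forall a x, chart_cod a x -> chart_dom a (param a x) ;
  chartK : forall a p, chart_dom a p -> param a (chart a p) = p ;
  paramK : forall a x, chart_cod a x -> chart a (param a x) = x ;
  chart_continuous : forall a p, chart_dom a p -> {for p, continuous (chart a)} ;
  param_continuous : forall a x, chart_cod a x -> {for x, continuous (param a)} ;
  transition_smooth : forall a b,
    smooth_on [set x | chart_cod a x /\ chart_dom b (param a x)]
      (fun x => chart b (param a x))
}.
Arguments chart_index {R n} M : rename.
Arguments chart_dom {R n M} a : rename.
Arguments chart_cod {R n M} a : rename.
Arguments chart {R n M} a p : rename.
Arguments param {R n M} a x : rename.

Definition overlap (R : realType) (n : nat) (M : smoothManifold R n)
    (a b : chart_index M) : set 'cV[R]_n :=
  [set x | chart_cod a x /\ chart_dom b (param a x)].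

Definition transition (R : realType) (n : nat) (M : smoothManifold R n)
    (a b : chart_index M) (x : 'cV[R]_n) : 'cV[R]_n :=
  chart b (param a x).

(* Fields on M are given by their components in every chart a, as functions on
   [chart_cod a]; tangent vectors at x in chart a are elements of R^n, and
   correspond to tangent vectors in chart b through ['d (transition a b) x]. *)

Definition vector_field (R : realType) (n : nat) (M : smoothManifold R n)
    (a : chart_index M) (X : 'cV[R]_n -> 'cV[R]_n) : Prop :=
  smooth_on (chart_cod a) X.

(* X and Y are the expressions in charts a and b of one and the same vector
   field over the intersection of the domains of a and b. *)
Definition same_field (R : realType) (n : nat) (M : smoothManifold R n)
    (a b : chart_index M) (X Y : 'cV[R]_n -> 'cV[R]_n) : Prop :=
  forall x, overlap a b x ->
    Y (transition a b x) = 'd (transition a b) x (X x).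

Definition lie_bracket (R : realType) (n : nat) (X Y : 'cV[R]_n -> 'cV[R]_n) :
    'cV[R]_n -> 'cV[R]_n :=
  fun x => 'D_(X x) Y x - 'D_(Y x) X x.

Record endoField (R : realType) (n : nat) (M : smoothManifold R n) := EndoField {
  endo_mx :> chart_index M -> 'cV[R]_n -> 'M[R]_n ;
  endo_smooth : forall a, smooth_on (chart_cod a) (endo_mx a) ;
  endo_compat : forall a b x, overlap a b x -> forall v : 'cV[R]_n,
    'd (transition a b) x (endo_mx a x *m v) =
      endo_mx b (transition a b x) *m 'd (transition a b) x v
}.

Definition endo_app (R : realType) (n : nat) (M : smoothManifold R n)
    (I : endoField M) (a : chart_index M) (X : 'cV[R]_n -> 'cV[R]_n) :
    'cV[R]_n -> 'cV[R]_n :=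
  fun x => I a x *m X x.

Definition bilin (R : realType) (n : nat) (G : 'M[R]_n) (u v : 'cV[R]_n) : R :=
  (u^T *m G *m v) 0 0.

Record riemannianMetric (R : realType) (n : nat) (M : smoothManifold R n) :=
  RiemannianMetric {
  metric_mx : chart_index M -> 'cV[R]_n -> 'M[R]_n ;
  metric_smooth : forall a, smooth_on (chart_cod a) (metric_mx a) ;
  metric_compat : forall a b x, overlap a b x -> forall u v : 'cV[R]_n,
    bilin (metric_mx b (transition a b x))
      ('d (transition a b) x u) ('d (transition a b) x v) =
    bilin (metric_mx a x) u v ;
  metric_sym : forall a x, chart_cod a x -> forall u v : 'cV[R]_n,
    bilin (metric_mx a x) u v = bilin (metric_mx a x) v u ;
  metric_pos : forall a x, chart_cod a x -> forall u : 'cV[R]_n,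
    u != 0 -> 0 < bilin (metric_mx a x) u u
}.

Definition metric_at (R : realType) (n : nat) (M : smoothManifold R n)
    (g : riemannianMetric M) (a : chart_index M) (x u v : 'cV[R]_n) : R :=
  bilin (metric_mx g a x) u v.
Coercion metric_at : riemannianMetric >-> Funclass.

Definition almost_complex (R : realType) (n : nat) (M : smoothManifold R n)
    (I : endoField M) : Prop :=
  forall a x, chart_cod a x -> I a x *m I a x = - 1%:M.

Definition nijenhuis (R : realType) (n : nat) (M : smoothManifold R n)
    (I : endoField M) (a : chart_index M) (X Y : 'cV[R]_n -> 'cV[R]_n) :
    'cV[R]_n -> 'cV[R]_n :=
  fun x => lie_bracket (endo_app I a X) (endo_app I a Y) x
    - endo_app I a (lie_bracket (endo_app I a X) Y) x
    - endo_app I a (lie_bracket X (endo_app I a Y)) x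
    - lie_bracket X Y x.

(* Integrability is the vanishing of the Nijenhuis tensor. *)
Definition complex_structure (R : realType) (n : nat) (M : smoothManifold R n)
    (I : endoField M) : Prop :=
  almost_complex I /\
  forall a X Y, vector_field a X -> vector_field a Y ->
    forall x, chart_cod a x -> nijenhuis I a X Y x = 0.

Definition hypercomplex (R : realType) (n : nat) (M : smoothManifold R n)
    (I1 I2 I3 : endoField M) : Prop :=
  [/\ complex_structure I1, complex_structure I2, complex_structure I3,
      (forall a x, chart_cod a x -> I1 a x *m I2 a x = I3 a x) &
      (forall a x, chart_cod a x -> I2 a x *m I1 a x = - I3 a x)].

Definition hermitian (R : realType) (n : nat) (M : smoothManifold R n)
    (I : endoField M) (g : riemannianMetric M) : Prop :=
  forall a x, chart_cod a x -> forall u v : 'cV[R]_n,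
    g a x u v = g a x (I a x *m u) (I a x *m v).

Definition hyper_hermitian (R : realType) (n : nat) (M : smoothManifold R n)
    (I1 I2 I3 : endoField M) (g : riemannianMetric M) : Prop :=
  hypercomplex I1 I2 I3 /\ [/\ hermitian I1 g, hermitian I2 g & hermitian I3 g].

(* [Gam i] is the matrix, in column convention, of v |-> Gam(e_i, v): its (k, j)
   entry is the Christoffel symbol Gam^k_ij. *)
Definition covariant_derivative (R : realType) (n : nat)
    (Gam : 'cV[R]_n -> 'I_n -> 'M[R]_n) (X Y : 'cV[R]_n -> 'cV[R]_n) :
    'cV[R]_n -> 'cV[R]_n :=
  fun x => 'D_(X x) Y x + \sum_(i < n) X x i 0 *: (Gam x i *m Y x).

(* The transformation law of the Christoffel symbols is expressed by saying that
   nabla_X Y is a vector field whose expressions in two charts agree. *)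
Record linearConnection (R : realType) (n : nat) (M : smoothManifold R n) :=
  LinearConnection {
  christoffel : chart_index M -> 'cV[R]_n -> 'I_n -> 'M[R]_n ;
  christoffel_smooth : forall a i,
    smooth_on (chart_cod a) (fun x => christoffel a x i) ;
  connection_compat : forall (a b : chart_index M)
      (X Y X' Y' : 'cV[R]_n -> 'cV[R]_n),
    smooth_on (overlap a b) X -> smooth_on (overlap a b) Y ->
    smooth_on (overlap b a) X' -> smooth_on (overlap b a) Y' ->
    same_field a b X X' -> same_field a b Y Y' ->
    same_field a b (covariant_derivative (christoffel a) X Y)
                   (covariant_derivative (christoffel b) X' Y')
}.

Definition nabla_at (R : realType) (n : nat) (M : smoothManifold R n)
    (nabla : linearConnection M) (a : chart_index M)
    (X Y : 'cV[R]_n -> 'cV[R]_n) : 'cV[R]_n -> 'cV[R]_n :=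
  covariant_derivative (christoffel nabla a) X Y.
Coercion nabla_at : linearConnection >-> Funclass.

Definition torsion (R : realType) (n : nat) (M : smoothManifold R n)
    (nabla : linearConnection M) (a : chart_index M)
    (X Y : 'cV[R]_n -> 'cV[R]_n) : 'cV[R]_n -> 'cV[R]_n :=
  fun x => nabla a X Y x - nabla a Y X x - lie_bracket X Y x.

Definition preserves_metric (R : realType) (n : nat) (M : smoothManifold R n)
    (nabla : linearConnection M) (g : riemannianMetric M) : Prop :=
  forall a X Y Z, vector_field a X -> vector_field a Y -> vector_field a Z ->
    forall x, chart_cod a x ->
      'D_(X x) (fun y => g a y (Y y) (Z y) : R^o) x =
        g a x (nabla a X Y x) (Z x) + g a x (Y x) (nabla a X Z x).

Definition preserves_endo (R : realType) (n : nat) (M : smoothManifold R n)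
    (nabla : linearConnection M) (I : endoField M) : Prop :=
  forall a X Y, vector_field a X -> vector_field a Y ->
    forall x, chart_cod a x ->
      nabla a X (endo_app I a Y) x = endo_app I a (nabla a X Y) x.

Definition hyper_hermitian_connection (R : realType) (n : nat)
    (M : smoothManifold R n) (I1 I2 I3 : endoField M) (g : riemannianMetric M)
    (nabla : linearConnection M) : Prop :=
  [/\ preserves_metric nabla g, preserves_endo nabla I1,
      preserves_endo nabla I2 & preserves_endo nabla I3].

Definition torsion_form (R : realType) (n : nat) (M : smoothManifold R n)
    (nabla : linearConnection M) (g : riemannianMetric M) (a : chart_index M)
    (X Y Z : 'cV[R]_n -> 'cV[R]_n) (x : 'cV[R]_n) : R :=
  g a x (X x) (torsion nabla a Y Z x).

Definition skew_torsion (R : realType) (n : nat) (M : smoothManifold R n)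
    (nabla : linearConnection M) (g : riemannianMetric M) : Prop :=
  forall a X Y Z, vector_field a X -> vector_field a Y -> vector_field a Z ->
    forall x, chart_cod a x ->
      torsion_form nabla g a Y X Z x = - torsion_form nabla g a X Y Z x /\
      torsion_form nabla g a X Z Y x = - torsion_form nabla g a X Y Z x.

Definition hkt_connection (R : realType) (n : nat) (M : smoothManifold R n)
    (I1 I2 I3 : endoField M) (g : riemannianMetric M)
    (nabla : linearConnection M) : Prop :=
  hyper_hermitian_connection I1 I2 I3 g nabla /\ skew_torsion nabla g.

Definition hkt_structure (R : realType) (n : nat) (M : smoothManifold R n)
    (I1 I2 I3 : endoField M) (g : riemannianMetric M) : Prop :=
  exists nabla : linearConnection M, hkt_connection I1 I2 I3 g nabla.

(* Components of a form of degree k with values in T; the k arguments are given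
   as a function on 'I_k.  Alternating multilinearity is not part of the type. *)
Definition diff_form (T : Type) (R : realType) (n : nat) (M : smoothManifold R n)
    (k : nat) : Type :=
  chart_index M -> 'cV[R]_n -> ('I_k -> 'cV[R]_n) -> T.

(* Exterior derivative in a chart:
   (d w)(v_0,..,v_k) = \sum_i (-1)^i D_{v_i} w(v_0,..,v_i omitted,..,v_k)
   for constant v_0,..,v_k. *)
Definition dR (R : realType) (n : nat) (M : smoothManifold R n) (k : nat)
    (w : diff_form R M k) : diff_form R M k.+1 :=
  fun a x v => \sum_(i < k.+1)
    (-1) ^+ i * 'D_(v i) (fun y => w a y (fun j => v (lift i j)) : R^o) x.

(* Complex-linear extension of the exterior derivative. *)
Definition dC (R : realType) (n : nat) (M : smoothManifold R n) (k : nat)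
    (w : diff_form R[i] M k) : diff_form R[i] M k.+1 :=
  fun a x v => (dR (fun b y u => complex.Re (w b y u)) a x v
             +i* dR (fun b y u => complex.Im (w b y u)) a x v)%C.

Definition endo_form (R : realType) (n : nat) (M : smoothManifold R n) (k : nat)
    (I : endoField M) (w : diff_form R[i] M k) : diff_form R[i] M k :=
  fun a x v => (-1) ^+ k * w a x (fun j => I a x *m v j).

Definition d_endo (R : realType) (n : nat) (M : smoothManifold R n) (k : nat)
    (I : endoField M) (w : diff_form R[i] M k) : diff_form R[i] M k.+1 :=
  fun a x v => (-1) ^+ k * endo_form I (dC (endo_form I w)) a x v.

Definition del (R : realType) (n : nat) (M : smoothManifold R n) (k : nat)
    (I : endoField M) (w : diff_form R[i] M k) : diff_form R[i] M k.+1 :=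
  fun a x v => 2^-1 * (dC w a x v + 'i%C * d_endo I w a x v).

Definition delbar (R : realType) (n : nat) (M : smoothManifold R n) (k : nat)
    (I : endoField M) (w : diff_form R[i] M k) : diff_form R[i] M k.+1 :=
  fun a x v => 2^-1 * (dC w a x v - 'i%C * d_endo I w a x v).

Definition form_vanishes (R : realType) (n : nat) (M : smoothManifold R n)
    (k : nat) (w : diff_form R[i] M k) : Prop :=
  forall a x v, chart_cod a x -> w a x v = 0.

Definition kahler_form (R : realType) (n : nat) (M : smoothManifold R n)
    (I : endoField M) (g : riemannianMetric M) : diff_form R M 2 :=
  fun a x v => g a x (I a x *m v ord0) (v ord_max).

Definition form_addi (R : realType) (n : nat) (M : smoothManifold R n) (k : nat)
    (w w' : diff_form R M k) : diff_form R[i] M k :=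
  fun a x v => ((w a x v)%:C + 'i * (w' a x v)%:C)%C.

Definition form_subi (R : realType) (n : nat) (M : smoothManifold R n) (k : nat)
    (w w' : diff_form R M k) : diff_form R[i] M k :=
  fun a x v => ((w a x v)%:C - 'i * (w' a x v)%:C)%C.

(* Main.v *)
(* The condition del_1 (F_2 + i F_3) = 0 unwinds, since I_1 F_a = - F_a for
   a = 2, 3, to dF_2(X,Y,Z) = dF_3(I_1 X, I_1 Y, I_1 Z), that is, to
   dF_2(I_2 ., I_2 ., I_2 .) = dF_3(I_3 ., I_3 ., I_3 .).
   If nabla preserves g and I_a and has skew torsion c, then writing dF_a and
   the Nijenhuis tensor of I_a in terms of c gives c = dF_a(I_a ., I_a ., I_a .),
   so an HKT-connection forces the equality of the two 3-forms.
   Conversely the Bismut connection of I_a is the metric connection whose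
   torsion is that 3-form, and it preserves I_a; when the 3-forms of I_2 and I_3
   coincide, so do their Bismut connections, which therefore preserve I_2, I_3
   and I_1 = I_2 I_3. *)
Require Import Defs.
From mathcomp Require Import all_boot all_order all_algebra.
From mathcomp Require Import all_classical all_reals all_analysis.
From mathcomp Require Import complex ring lra.
Set Implicit Arguments.
Unset Strict Implicit.
Unset Printing Implicit Defensive.
Import Order.TTheory GRing.Theory Num.Theory.
Import numFieldNormedType.Exports.
Local Open Scope classical_set_scope.
Local Open Scope ring_scope.

(** * Matrix-valued maps *)

(** A connection is by definition a family of smooth Christoffel symbols obeying a law under change
    of charts, so the obstacle is to produce the Bismut connection as such an object. Its symbols
    are defined chart by chart by the Koszul formula with half the torsion form added; they are
    smooth because the inverse metric is given by Cramer's rule. Differentiating a tensor across a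
    change of charts adds terms containing the Hessian of the transition map. Since the Hessian is
    symmetric, these terms cancel in dF against the skewness of F, and in the Koszul combination
    they leave exactly the inhomogeneous term of the Christoffel law. This is why the symmetry of
    second derivatives is established for [smooth_on], which speaks only of iterated directional
    derivatives. The conditions on a connection are tensorial and can be tested on constant fields
    in a chart. There they become relations between the values of Dg, DI, DF and g(Gam(., .), .),
    linear once the signs coming from I^2 = -1 are pulled out, and [lra] settles them. Integrability
    enters as such a relation: the Nijenhuis tensor evaluated on constant fields. *)

Section NearDifferentiable.
Variables (R : realType) (V W : normedModType R).
Implicit Types f g : V -> W.

Lemma near_eq_differentiable f g x :
  (\near x, f x = g x) -> differentiable f x -> differentiable g x.
Proof.
move=> fg df.
have [dfc dfE] := (diff_locallyP x f).1 df.
have fg0 : \forall y \near 0, f (y + x) = g (y + x).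
  have c0 : (fun y : V => y + x) @ nbhs 0 --> x.
    by rewrite -[X in _ --> X]add0r; apply: cvgD; [exact: cvg_id|exact: cvg_cst].
  exact: c0 fg.
have gE : g \o shift x = cst (g x) + 'd f x +o_ 0 id.
  have fgx : f x = g x := nbhs_singleton fg.
  apply/eqaddoP => e e0.
  move: dfE => /eqaddoP /(_ e e0).
  apply: filterS2 fg0 => y /= fgy.
  by rewrite !fctE /= -fgy -fgx.
by apply/diff_locallyP; rewrite (diff_unique dfc gE).
Qed.

End NearDifferentiable.

Section MatrixCalculus.
Variables (R : realType) (V : normedModType R).

Lemma differentiable_mxP m p (M : V -> 'M[R]_(m, p)) x :
  differentiable M x <-> forall i j, differentiable (fun y => M y i j : R) x.
Proof.
split=> [dM i j|dM].
  exact: (@differentiable_comp _ _ _ _ M (fun N : 'M[R]_(m, p) => N i j : R) x dM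
    (differentiable_coord _ i j)).
have -> : M = \sum_(i < m) \sum_(j < p) (fun y => M y i j *: delta_mx i j).
  apply/funext => y; rewrite {1}[M y]matrix_sum_delta fct_sumE.
  by apply: eq_bigr => i _; rewrite fct_sumE.
apply: (@differentiable_sum R V _ m) => i; apply: (@differentiable_sum R V _ p) => j.
exact: differentiableZl.
Qed.

Lemma differentiable_mulmx m p q (A : V -> 'M[R]_(m, p)) (B : V -> 'M[R]_(p, q)) x :
  differentiable A x -> differentiable B x -> differentiable (fun y => A y *m B y) x.
Proof.
move=> /differentiable_mxP dA /differentiable_mxP dB.
apply/differentiable_mxP => i j.
have -> : (fun y => (A y *m B y) i j : R)
    = \sum_(k < p) ((fun y => A y i k : R) * (fun y => B y k j : R)).
  by apply/funext => y; rewrite mxE fct_sumE.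
by apply: (@differentiable_sum R V _ p) => k; apply: differentiableM.
Qed.

Lemma derive_mulmx m p q (A : V -> 'M[R]_(m, p)) (B : V -> 'M[R]_(p, q)) x v :
  differentiable A x -> differentiable B x ->
  'D_v (fun y => A y *m B y) x = 'D_v A x *m B x + A x *m 'D_v B x.
Proof.
move=> dA dB.
have DA := @diff_derivable _ _ _ _ _ v dA; have DB := @diff_derivable _ _ _ _ _ v dB.
have DAB := @diff_derivable _ _ _ _ _ v (differentiable_mulmx dA dB).
rewrite (derive_mx DAB) (derive_mx DA) (derive_mx DB).
apply/matrixP => i j; rewrite !mxE.
have -> : (fun y => (A y *m B y) i j : R)
    = \sum_(k < p) ((fun y => A y i k : R) * (fun y => B y k j : R)).
  by apply/funext => y; rewrite mxE fct_sumE.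
move: DA DB => /derivable_mxP DA /derivable_mxP DB.
rewrite derive_sum => [|k]; last exact: derivableM.
rewrite -big_split; apply: eq_bigr => k _.
by rewrite deriveM // !mxE /= addrC; congr (_ + _); exact: mulrC.
Qed.

Lemma derive_mxE m p (M : V -> 'M[R]_(m, p)) x v i j : differentiable M x ->
  ('D_v M x) i j = 'D_v (fun y => M y i j : R) x.
Proof. by move=> /(@diff_derivable _ _ _ _ _ v)/derive_mx ->; rewrite mxE. Qed.

End MatrixCalculus.

(** * Smooth maps *)

Section SmoothOn.
Variables (R : realType) (V : normedModType R) (U : set V).
Hypothesis U_open : open U.

Lemma eq_derive_on (W : normedModType R) (f g : V -> W) x v :
  {in U, f =1 g} -> U x -> 'D_v f x = 'D_v g x.
Proof.
move=> fg Ux; apply: near_eq_derive.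
by apply: filterS (open_nbhs_nbhs (conj U_open Ux)) => y Uy; apply: fg; exact: mem_set.
Qed.

Lemma eq_differentiable_on (W : normedModType R) (f g : V -> W) x :
  {in U, f =1 g} -> U x -> differentiable f x -> differentiable g x.
Proof.
move=> fg Ux; apply: near_eq_differentiable.
by apply: filterS (open_nbhs_nbhs (conj U_open Ux)) => y Uy; apply: fg; exact: mem_set.
Qed.

(** Components of fields are meaningful on the codomain of a chart only, so every formula for a
    derivative holds on [U] only. Openness of [U] lets the derivatives inherit the equality, and the
    induction can continue. *)
Lemma eq_Ck_on (W : normedModType R) k (f g : V -> W) :
  {in U, f =1 g} -> Ck_on U k f -> Ck_on U k g.
Proof.
elim: k f g => [|k IHk] f g fg /=.
  move=> fc x Ux; have := fc _ Ux; rewrite /prop_for /continuous_at.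
  rewrite (fg x (mem_set Ux)); apply: cvg_trans; apply: near_eq_cvg.
  by apply: filterS (open_nbhs_nbhs (conj U_open Ux)) => y Uy; apply/fg/mem_set.
move=> [df Df]; split=> [x Ux|v].
  exact: eq_differentiable_on (df x Ux).
by apply: IHk (Df v) => x /set_mem Ux; exact: eq_derive_on.
Qed.

Lemma eq_smooth_on (W : normedModType R) (f g : V -> W) :
  {in U, f =1 g} -> smooth_on U f -> smooth_on U g.
Proof. by move=> fg sf k; apply: eq_Ck_on (sf k). Qed.

Lemma smooth_on_differentiable (W : normedModType R) (f : V -> W) x :
  smooth_on U f -> U x -> differentiable f x.
Proof. by move=> /(_ 1%N)[+ _] Ux; exact. Qed.

Lemma smooth_on_derive (W : normedModType R) (f : V -> W) v :
  smooth_on U f -> smooth_on U (fun x => 'D_v f x).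
Proof. by move=> sf k; case: (sf k.+1) => _; exact. Qed.

Lemma smooth_on_cst (W : normedModType R) (w : W) : smooth_on U (fun=> w).
Proof.
move=> k; elim: k w => [|k IHk] w /=; first by move=> x _; exact: cvg_cst.
split=> [x _|v]; first exact: differentiable_cst.
by apply: eq_Ck_on (IHk 0) => x _; rewrite derive_cst.
Qed.

Lemma Ck_onD (W : normedModType R) k (f g : V -> W) :
  Ck_on U k f -> Ck_on U k g -> Ck_on U k (fun x => f x + g x).
Proof.
elim: k f g => [|k IHk] f g /=.
  by move=> fc gc x Ux; apply: cvgD; [exact: fc|exact: gc].
move=> [df Df] [dg Dg]; split=> [x Ux|v].
  by apply: differentiableD; [exact: df|exact: dg].
apply: eq_Ck_on (IHk _ _ (Df v) (Dg v)) => x /set_mem Ux.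
by rewrite -deriveD //; apply: diff_derivable; [exact: df|exact: dg].
Qed.

Lemma smooth_onD (W : normedModType R) (f g : V -> W) :
  smooth_on U f -> smooth_on U g -> smooth_on U (fun x => f x + g x).
Proof. by move=> sf sg k; apply: Ck_onD. Qed.

(** The Leibniz rule leaves one factor undifferentiated, and that factor has to be reread one order
    lower. *)
Lemma Ck_onW (W : normedModType R) k (f : V -> W) : Ck_on U k.+1 f -> Ck_on U k f.
Proof.
elim: k f => [|k IHk] f [df Df].
  by move=> x Ux; apply: differentiable_continuous; exact: df.
by split=> // v; apply: IHk; exact: Df.
Qed.

Lemma Ck_onM k (f g : V -> R) :
  Ck_on U k f -> Ck_on U k g -> Ck_on U k (fun x => f x * g x).
Proof.
elim: k f g => [|k IHk] f g.
  by move=> fc gc x Ux; apply: cvgM; [exact: fc|exact: gc].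
move=> Cf Cg; have [df Df] := Cf; have [dg Dg] := Cg; split=> [x Ux|v].
  by apply: differentiableM; [exact: df|exact: dg].
have := Ck_onD (IHk _ _ (Ck_onW Cf) (Dg v)) (IHk _ _ (Ck_onW Cg) (Df v)).
apply: eq_Ck_on => x /set_mem Ux.
by rewrite -[RHS]/('D_v (f * g) x) deriveM //; apply: diff_derivable; [exact: df|exact: dg].
Qed.

Lemma smooth_onM (f g : V -> R) :
  smooth_on U f -> smooth_on U g -> smooth_on U (fun x => f x * g x).
Proof. by move=> sf sg k; apply: Ck_onM. Qed.

Lemma smooth_onN (f : V -> R) :
  smooth_on U f -> smooth_on U (fun x => - f x).
Proof.
move=> sf; apply: eq_smooth_on (smooth_onM (smooth_on_cst (-1 : R)) sf) => x _.
by rewrite mulN1r.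
Qed.

(** The derivative of 1/f is -(1/f)^2 D_v f: it involves 1/f itself, which is known at the previous
    order, and so the induction on the order closes. *)
Lemma smooth_onV (f : V -> R) : (forall x, U x -> f x != 0) ->
  smooth_on U f -> smooth_on U (fun x => (f x)^-1).
Proof.
move=> f0 sf; have df x : U x -> differentiable f x by exact: smooth_on_differentiable.
have dfV x : U x -> differentiable (fun y => (f y)^-1) x.
  by move=> Ux; apply: differentiableV; [exact: df|exact: f0].
elim=> [|k IHk]; first by move=> x Ux; apply: differentiable_continuous; exact: dfV.
split=> // v.
have := Ck_onM (Ck_onM IHk IHk) (smooth_onN (smooth_on_derive v sf) k).
apply: eq_Ck_on => x /set_mem Ux.
have Dfv := diff_derivable (df x Ux).
by rewrite deriveV ?f0 // -[RHS]/(_ * _) mulrN mulNr -invfM -expr2.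
Qed.

Lemma smooth_on_sum (I : Type) (r : seq I) (P : pred I) (W : normedModType R)
    (F : I -> V -> W) :
  (forall i, P i -> smooth_on U (F i)) -> smooth_on U (fun x => \sum_(i <- r | P i) F i x).
Proof.
move=> sF; elim: r => [|i r IHr].
  by apply: eq_smooth_on (smooth_on_cst 0) => x _; rewrite big_nil.
case: (boolP (P i)) => Pi; last by apply: eq_smooth_on IHr => x _; rewrite big_cons (negPf Pi).
by apply: eq_smooth_on (smooth_onD (sF i Pi) IHr) => x _; rewrite big_cons Pi.
Qed.

Lemma smooth_on_prod (I : Type) (r : seq I) (P : pred I) (F : I -> V -> R) :
  (forall i, P i -> smooth_on U (F i)) -> smooth_on U (fun x => \prod_(i <- r | P i) F i x).
Proof.
move=> sF; elim: r => [|i r IHr].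
  by apply: eq_smooth_on (smooth_on_cst (1 : R)) => x _; rewrite big_nil.
case: (boolP (P i)) => Pi; last by apply: eq_smooth_on IHr => x _; rewrite big_cons (negPf Pi).
by apply: eq_smooth_on (smooth_onM (sF i Pi) IHr) => x _; rewrite big_cons Pi.
Qed.

Lemma smooth_on_mxP m p (M : V -> 'M[R]_(m, p)) :
  smooth_on U M <-> forall i j, smooth_on U (fun x => M x i j : R).
Proof.
split=> [sM i j k|sM k].
  elim: k M sM => [|k IHk] M sM.
    move=> x Ux; apply: differentiable_continuous.
    exact: (differentiable_mxP M x).1 (smooth_on_differentiable sM Ux) i j.
  split=> [x Ux|v].
    exact: (differentiable_mxP M x).1 (smooth_on_differentiable sM Ux) i j.
  apply: eq_Ck_on (IHk _ (smooth_on_derive v sM)) => x /set_mem Ux.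
  by rewrite derive_mxE //; exact: smooth_on_differentiable.
elim: k M sM => [|k IHk] M sM.
  move=> x Ux; apply: differentiable_continuous; apply/differentiable_mxP => i j.
  exact: smooth_on_differentiable (sM i j) Ux.
have dM x : U x -> differentiable M x.
  move=> Ux; apply/differentiable_mxP => i j.
  exact: smooth_on_differentiable (sM i j) Ux.
split=> // v; apply: IHk => i j.
apply: eq_smooth_on (smooth_on_derive v (sM i j)) => x /set_mem Ux.
by rewrite derive_mxE //; exact: dM.
Qed.

Lemma smooth_on_trmx m p (M : V -> 'M[R]_(m, p)) :
  smooth_on U M -> smooth_on U (fun x => (M x)^T).
Proof.
move=> /smooth_on_mxP sM; apply/smooth_on_mxP => i j.
by apply: (@eq_smooth_on _ (fun x => M x j i) _ _ (sM j i)) => x _; rewrite mxE.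
Qed.

Lemma smooth_on_mulmx m p q (A : V -> 'M[R]_(m, p)) (B : V -> 'M[R]_(p, q)) :
  smooth_on U A -> smooth_on U B -> smooth_on U (fun x => A x *m B x).
Proof.
move=> /smooth_on_mxP sA /smooth_on_mxP sB; apply/smooth_on_mxP => i j.
apply: (@eq_smooth_on _ (fun x => \sum_(k < p) A x i k * B x k j)).
  by move=> x _; rewrite mxE.
by apply: smooth_on_sum => k _; exact: smooth_onM.
Qed.

Lemma smooth_on_det m (A : V -> 'M[R]_m) :
  smooth_on U A -> smooth_on U (fun x => \det (A x)).
Proof.
move=> /smooth_on_mxP sA; rewrite /determinant.
apply: smooth_on_sum => s _; apply: smooth_onM; first exact: smooth_on_cst.
by apply: smooth_on_prod => i _; exact: sA.
Qed.

(** Cramer's rule: the entries of the inverse are cofactors divided by the determinant. *)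
Lemma smooth_on_invmx m (A : V -> 'M[R]_m) : (forall x, U x -> A x \in unitmx) ->
  smooth_on U A -> smooth_on U (fun x => invmx (A x)).
Proof.
move=> uA sA; have det0 x : U x -> \det (A x) != 0.
  by move=> /uA; rewrite unitmxE unitfE.
apply/smooth_on_mxP => i j.
apply: (@eq_smooth_on _
  (fun x => (\det (A x))^-1 * ((-1) ^+ (j + i) * \det (row' j (col' i (A x)))))).
  by move=> x /set_mem Ux; rewrite /invmx uA // !mxE.
apply: smooth_onM; first by apply: smooth_onV => //; exact: smooth_on_det.
apply: smooth_onM; first exact: smooth_on_cst.
apply: smooth_on_det; apply/smooth_on_mxP => k l.
move: sA => /smooth_on_mxP /(_ (lift j k) (lift i l)).
by apply: eq_smooth_on => x _; rewrite !mxE.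
Qed.

End SmoothOn.

(** * Symmetry of second derivatives *)

Section MixedDerivatives.
Variables (R : realType) (V : normedModType R).

Lemma is_derive_line (W : normedModType R) (f : V -> W) (y u : V) (s : R) :
  differentiable f (y + s *: u) ->
  is_derive s 1 (fun t : R => f (y + t *: u)) ('D_u f (y + s *: u)).
Proof.
move=> df; pose l : R -> V := cst y + ( *:%R^~ u).
have lE t : l t = y + t *: u by [].
have dl : is_diff s l (0 + ( *:%R^~ u)) by apply: is_diffD.
have dfl : differentiable (f \o l) s by apply: differentiable_comp.
apply: DeriveDef; first exact: (diff_derivable dfl).
rewrite -[LHS]/('D_1 (f \o l) s) (deriveE _ dfl) (deriveE _ df).
by rewrite diff_comp //= diff_val /= fctE scale1r add0r.
Qed.

Lemma MVT_line (f : V -> R) (y u : V) (h : R) : 0 < h ->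
  (forall s, 0 <= s <= h -> differentiable f (y + s *: u)) ->
  exists2 s, 0 <= s <= h & f (y + h *: u) - f y = 'D_u f (y + s *: u) * h.
Proof.
move=> h0 df.
have isd s : s \in `[0, h] ->
      is_derive s 1 (fun t : R => f (y + t *: u)) ('D_u f (y + s *: u)).
  by rewrite in_itv /= => /df; exact: is_derive_line.
have cf : {within `[0, h], continuous (fun t : R => f (y + t *: u))}.
  by apply: derivable_within_continuous => t /isd[].
have [s] := MVT h0 (fun s sh => isd s (subset_itv_oo_cc sh)) cf.
rewrite in_itv /= => /andP[s0 sh]; rewrite scale0r addr0 subr0 => fE.
by exists s => //; rewrite !ltW.
Qed.

Lemma differentiable_translate (W : normedModType R) (f : V -> W) (w y : V) :
  differentiable f (y + w) -> differentiable (fun z => f (z + w)) y.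
Proof.
move=> df; pose l : V -> V := id + cst w.
have dl : is_diff y l (id + 0) by apply: is_diffD.
exact: (@differentiable_comp _ _ _ _ l f).
Qed.

Lemma derive_translate (W : normedModType R) (f : V -> W) (w y u : V) :
  'D_u (fun z => f (z + w)) y = 'D_u f (y + w).
Proof. by rewrite /derive; under eq_fun do rewrite /= -addrA. Qed.

Definition second_difference (f : V -> R) (x u v : V) (h : R) : R :=
  f (x + h *: u + h *: v) - f (x + h *: u) - (f (x + h *: v) - f x).

Lemma second_differenceC f x u v h :
  second_difference f x u v h = second_difference f x v u h.
Proof. by rewrite /second_difference (addrAC x (h *: u)) addrAC !opprB; ring. Qed.

Lemma second_difference_MVT (f : V -> R) (x u v : V) (h : R) : 0 < h ->
  (forall s t, 0 <= s <= h -> 0 <= t <= h ->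
     differentiable f (x + s *: u + t *: v) /\
     differentiable ('D_u f) (x + s *: u + t *: v)) ->
  exists s t, [/\ 0 <= s <= h, 0 <= t <= h &
    second_difference f x u v h = 'D_v ('D_u f) (x + s *: u + t *: v) * h * h].
Proof.
move=> h0 df; have hh : 0 <= h <= h by rewrite ltW /=.
have h00 : 0 <= (0 : R) <= h by rewrite lexx ltW.
(* The second difference is the increment of [g] along [u]. The mean value theorem for [g] along
   [u], then for ['D_u f] along [v], yields the two factors [h]. *)
pose g y := f (y + h *: v) - f y.
have df1 s : 0 <= s <= h -> differentiable (fun y => f (y + h *: v)) (x + s *: u).
  by move=> sh; apply: differentiable_translate; have [] := df s h sh hh.
have df0 s : 0 <= s <= h -> differentiable f (x + s *: u).
  by move=> sh; have [] := df s 0 sh h00; rewrite scale0r addr0.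
have dg s : 0 <= s <= h -> differentiable g (x + s *: u).
  by move=> sh; apply: differentiableB; [exact: df1|exact: df0].
have [s sh gE] := MVT_line h0 dg.
have Dg : 'D_u g (x + s *: u) = 'D_u f (x + s *: u + h *: v) - 'D_u f (x + s *: u).
  rewrite -[LHS]/('D_u ((fun y => f (y + h *: v)) - f) _) deriveB ?derive_translate //.
    exact/diff_derivable/df1.
  exact/diff_derivable/df0.
have [t th fE] := @MVT_line ('D_u f) (x + s *: u) v h h0 (fun t th => (df s t sh th).2).
by exists s, t; split => //; rewrite -[LHS]/(g (x + h *: u) - g x) gE Dg fE.
Qed.

(** Schwarz's argument. The second difference is symmetric in [u] and [v], so it equals h^2 times
    either mixed derivative, each at some point near [x]. If the two values at [x] differed,
    continuity with tolerance half their distance would make that distance smaller than itself. *)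
Lemma derive_sym (f : V -> R) (U : set V) (x u v : V) :
  open U -> smooth_on U f -> U x -> 'D_v ('D_u f) x = 'D_u ('D_v f) x.
Proof.
move=> oU sf Ux; apply/eqP; rewrite -subr_eq0; apply/negPn/negP => ne0.
set a := 'D_v _ x in ne0 *; set b := 'D_u _ x in ne0 *.
have e0 : 0 < `|a - b| / 2 by rewrite divr_gt0 // normr_gt0.
have near_of w w' : \forall y \near x, `|'D_w ('D_w' f) x - 'D_w ('D_w' f) y| < `|a - b| / 2.
  have s2 := smooth_on_derive w (smooth_on_derive w' sf).
  have := differentiable_continuous (smooth_on_differentiable s2 Ux).
  by move=> /cvgrPdist_lt /(_ _ e0).
have nbhs_close : nbhs x (U `&` ([set y | `|a - 'D_v ('D_u f) y| < `|a - b| / 2] `&`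
                                [set y | `|b - 'D_u ('D_v f) y| < `|a - b| / 2])).
  exact: (filterI (open_nbhs_nbhs (conj oU Ux)) (filterI (near_of v u) (near_of u v))).
have /nbhs_ballP[r /= r0 ball_r] := nbhs_close.
(* All points x + s u + t v with s, t in [0, h] then lie in the ball of radius [r]; the summand 1
   keeps the denominator positive when both vectors vanish. *)
pose h := r / (`|u| + `|v| + 1).
have c0 : 0 < `|u| + `|v| + 1 by rewrite ltr_wpDl // addr_ge0.
have h0 : 0 < h by rewrite divr_gt0.
have in_ball s t w w' : `|w| + `|w'| = `|u| + `|v| ->
    0 <= s <= h -> 0 <= t <= h -> ball x r (x + s *: w + t *: w').
  move=> ww /andP[s0 sh] /andP[t0 th]; rewrite -ball_normE /= -addrA opprD addNKr normrN.
  apply: (le_lt_trans (ler_normD _ _)); rewrite !normrZ !ger0_norm //.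
  apply: (@le_lt_trans _ _ (h * (`|u| + `|v|))).
    by rewrite -ww mulrDr lerD // ler_wpM2r.
  by rewrite /h mulrAC ltr_pdivrMr // ltr_pM2l // ltrDl.
have diff2 w w' : `|w| + `|w'| = `|u| + `|v| -> forall s t, 0 <= s <= h -> 0 <= t <= h ->
    differentiable f (x + s *: w + t *: w') /\ differentiable ('D_w f) (x + s *: w + t *: w').
  move=> ww s t sh th; have [Uy _] := ball_r _ (in_ball s t w w' ww sh th).
  split; first exact: smooth_on_differentiable sf Uy.
  exact: smooth_on_differentiable (smooth_on_derive w sf) Uy.
have [s [t [sh th Ea]]] := second_difference_MVT h0 (diff2 u v erefl).
have [s' [t' [sh' th' Eb]]] := second_difference_MVT h0 (diff2 v u (addrC _ _)).
have [_ [/= + _]] := ball_r _ (in_ball s t u v erefl sh th).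
have [_ [_ /= +]] := ball_r _ (in_ball s' t' v u (addrC _ _) sh' th').
move: Ea; rewrite second_differenceC Eb => /(mulIf (lt0r_neq0 h0))/(mulIf (lt0r_neq0 h0)) ->.
clearbody a b; move=> lb la; have : `|a - b| < `|a - b| / 2 + `|a - b| / 2.
  apply: le_lt_trans (ltrD la lb).
  by rewrite (distrC b _); exact: ler_distD.
by rewrite -splitr ltxx.
Qed.

End MixedDerivatives.

(** * Bilinear forms and directional derivatives *)

Section Bilin.
Variables (R : realType) (n : nat).
Implicit Types (G H A : 'M[R]_n) (u v w : 'cV[R]_n) (c : R).

Lemma bilinDl G u v w : bilin G (u + v) w = bilin G u w + bilin G v w.
Proof. by rewrite /bilin linearD !mulmxDl mxE. Qed.

Lemma bilinDr G u v w : bilin G u (v + w) = bilin G u v + bilin G u w.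
Proof. by rewrite /bilin mulmxDr mxE. Qed.

Lemma bilinZl G c u v : bilin G (c *: u) v = c * bilin G u v.
Proof. by rewrite /bilin linearZ -!scalemxAl mxE. Qed.

Lemma bilinZr G c u v : bilin G u (c *: v) = c * bilin G u v.
Proof. by rewrite /bilin -scalemxAr mxE. Qed.

Lemma bilinNl G u v : bilin G (- u) v = - bilin G u v.
Proof. by rewrite -scaleN1r bilinZl mulN1r. Qed.

Lemma bilinNr G u v : bilin G u (- v) = - bilin G u v.
Proof. by rewrite -scaleN1r bilinZr mulN1r. Qed.

Lemma bilinD G H u v : bilin (G + H) u v = bilin G u v + bilin H u v.
Proof. by rewrite /bilin mulmxDr mulmxDl mxE. Qed.

Lemma bilinZ c G u v : bilin (c *: G) u v = c * bilin G u v.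
Proof. by rewrite /bilin -scalemxAr -scalemxAl mxE. Qed.

Lemma bilinN G u v : bilin (- G) u v = - bilin G u v.
Proof. by rewrite -scaleN1r bilinZ mulN1r. Qed.

Lemma bilin_mull A G u v : bilin (A^T *m G) u v = bilin G (A *m u) v.
Proof. by rewrite /bilin trmx_mul !mulmxA. Qed.

Lemma bilin_eq0r G u : G \in unitmx -> (forall v, bilin G u v = 0) -> u = 0.
Proof.
move=> uG u0; have uG0 : u^T *m G = 0.
  by apply/rowP => j; have := u0 (delta_mx j 0); rewrite /bilin -colE !mxE.
by apply: trmx_inj; rewrite trmx0 -(mulmxK uG u^T) uG0 mul0mx.
Qed.

Lemma posdef_unitmx G : (forall u, u != 0 -> 0 < bilin G u u) -> G \in unitmx.
Proof.
move=> G0; apply: contraT; rewrite unitmxE unitfE negbK => /eqP dG.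
have [v v0 vG] : exists2 v : 'rV[R]_n, v != 0 & v *m G = 0 by apply/det0P/eqP.
have vT0 : v^T != 0 by rewrite -trmx0 (inj_eq trmx_inj).
by have := G0 _ vT0; rewrite /bilin trmxK vG mul0mx mxE ltxx.
Qed.

Lemma sum_delta_cV u : u = \sum_(i < n) u i 0 *: delta_mx i 0.
Proof. by rewrite [LHS]matrix_sum_delta; apply: eq_bigr => i _; rewrite big_ord1. Qed.

End Bilin.

Section Directional.
Variables (R : realType) (n : nat) (W : normedModType R).
Implicit Types (f : 'cV[R]_n -> W) (x u v : 'cV[R]_n).

Lemma deriveDdir f x u v : differentiable f x -> 'D_(u + v) f x = 'D_u f x + 'D_v f x.
Proof. by move=> df; rewrite !deriveE // linearD. Qed.

Lemma deriveZdir f x c u : differentiable f x -> 'D_(c *: u) f x = c *: 'D_u f x.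
Proof. by move=> df; rewrite !deriveE // linearZ. Qed.

Lemma deriveNdir f x u : differentiable f x -> 'D_(- u) f x = - 'D_u f x.
Proof. by move=> df; rewrite !deriveE // linearN. Qed.

Lemma derive_sum_delta f x u : differentiable f x ->
  'D_u f x = \sum_(i < n) u i 0 *: 'D_(delta_mx i 0) f x.
Proof.
move=> df; rewrite deriveE // [in LHS](sum_delta_cV u) linear_sum.
by apply: eq_bigr => i _; rewrite linearZ deriveE.
Qed.

End Directional.

Lemma derive_comp (R : realType) (U V W : normedModType R) (f : U -> V) (g : V -> W) x u :
  differentiable f x -> differentiable g (f x) ->
  'D_u (g \o f) x = 'D_('D_u f x) g (f x).
Proof.
move=> df dg; rewrite (deriveE u df) (deriveE _ dg).
by rewrite (deriveE u (differentiable_comp df dg)) diff_comp.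
Qed.

Section SmoothChart.
Variables (R : realType) (n : nat) (U : set 'cV[R]_n).
Hypothesis U_open : open U.

(** By definition [smooth_on] is stable under derivatives in a fixed direction; a moving direction
    is expanded over the standard basis, with smooth coefficients. *)
Lemma smooth_on_derive_along m p (B : 'cV[R]_n -> 'M[R]_(m, p)) (u : 'cV[R]_n -> 'cV[R]_n) :
  smooth_on U B -> smooth_on U u -> smooth_on U (fun x => 'D_(u x) B x).
Proof.
move=> sB /(smooth_on_mxP U_open) su; apply/(smooth_on_mxP U_open) => i j.
apply: (@eq_smooth_on _ _ _ U_open _
  (fun x => \sum_(k < n) u x k 0 * ('D_(delta_mx k 0) B x) i j)).
  move=> x /set_mem Ux; rewrite derive_sum_delta ?summxE; last first.
    exact: smooth_on_differentiable sB Ux.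
  by apply: eq_bigr => k _; rewrite mxE.
apply: smooth_on_sum => // k _; apply: smooth_onM => //.
by move: (smooth_on_derive (delta_mx k 0) sB) => /(smooth_on_mxP U_open).
Qed.

Lemma smooth_on_bilin (B : 'cV[R]_n -> 'M[R]_n) (u v : 'cV[R]_n -> 'cV[R]_n) :
  smooth_on U B -> smooth_on U u -> smooth_on U v ->
  smooth_on U (fun x => bilin (B x) (u x) (v x)).
Proof.
move=> sB su sv; have : smooth_on U (fun x => (u x)^T *m B x *m v x).
  by do 2?[apply: smooth_on_mulmx => //]; exact: smooth_on_trmx.
by move=> /(smooth_on_mxP U_open) /(_ 0 0).
Qed.

Lemma derive_sym_mx m p (f : 'cV[R]_n -> 'M[R]_(m, p)) x u v :
  smooth_on U f -> U x -> 'D_v ('D_u f) x = 'D_u ('D_v f) x.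
Proof.
move=> sf Ux; apply/matrixP => i j.
have entry w w' : ('D_w ('D_w' f) x) i j = 'D_w ('D_w' (fun y => f y i j : R)) x.
  rewrite derive_mxE; last exact: smooth_on_differentiable (smooth_on_derive w' sf) Ux.
  apply: (eq_derive_on U_open) => // y /set_mem Uy.
  by rewrite derive_mxE //; exact: smooth_on_differentiable sf Uy.
have sfij := (smooth_on_mxP U_open f).1 sf i j.
exact: etrans (entry v u) (etrans (derive_sym u v U_open sfij Ux) (esym (entry u v))).
Qed.

End SmoothChart.

Section DeriveBilin.
Variables (R : realType) (n : nat) (V : normedModType R).

Lemma differentiable_trmx m p (A : V -> 'M[R]_(m, p)) x :
  differentiable A x -> differentiable (fun y => (A y)^T) x.
Proof.
move=> /differentiable_mxP dA; apply/differentiable_mxP => i j.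
by under eq_fun do rewrite mxE; exact: dA.
Qed.

Lemma derive_trmx m p (A : V -> 'M[R]_(m, p)) x v : differentiable A x ->
  'D_v (fun y => (A y)^T) x = ('D_v A x)^T.
Proof.
move=> dA; apply/matrixP => i j; rewrite mxE !derive_mxE //; last exact: differentiable_trmx.
by under eq_fun do rewrite mxE.
Qed.

Lemma derive_bilin (B : V -> 'M[R]_n) (Y Z : V -> 'cV[R]_n) x w :
  differentiable B x -> differentiable Y x -> differentiable Z x ->
  'D_w (fun y => bilin (B y) (Y y) (Z y) : R^o) x =
  bilin ('D_w B x) (Y x) (Z x) + bilin (B x) ('D_w Y x) (Z x) + bilin (B x) (Y x) ('D_w Z x).
Proof.
move=> dB dY dZ; have dYt := differentiable_trmx dY.
have dYB := differentiable_mulmx dYt dB.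
rewrite /bilin -derive_mxE; last exact: differentiable_mulmx.
rewrite derive_mulmx // derive_mulmx // derive_trmx // !mulmxDl !mxE.
by congr (_ + _); rewrite addrC.
Qed.

Lemma derive_bilin_cst (B : V -> 'M[R]_n) x w u v : differentiable B x ->
  'D_w (fun y => bilin (B y) u v : R^o) x = bilin ('D_w B x) u v.
Proof.
move=> dB; rewrite derive_bilin // !derive_cst.
by rewrite -(scale0r 0) bilinZl bilinZr !mul0r !addr0.
Qed.

End DeriveBilin.

(** * Pointwise Hermitian algebra *)

(** If A(u, v, w) = (D_u F)(v, w) for a 2-form F, this is dF evaluated on constant fields. *)
Definition ext3 (V : Type) (R : zmodType) (A : V -> V -> V -> R) (u v w : V) : R :=
  A u v w - A v u w + A w u v.

(* At a point, [a u v w], [n u v w] and [A u v w] stand for (D_u g)(v, w),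
   g((D_u J) v, w) and (D_u F)(v, w), and [t u v w] for g(Gam(u, v), w).  They are
   kept abstract so that no tactic tries to convert directional derivatives. *)
Section HermitianAlgebra.
Variables (R : realFieldType) (V : zmodType) (J : V -> V).
Hypothesis JK : forall v, J (J v) = - v.

Let JN v : J (- v) = - J v. Proof. by rewrite -[in LHS]JK JK. Qed.

(** The left-hand side is g(N(u, v), w) for constant fields u, v, with the outer factors J moved
    onto w by skewness. *)
Let nijenhuis_free (n : V -> V -> V -> R) := forall u v w,
  n (J u) v w - n (J v) u w - n v u (J w) + n u v (J w) = 0.

(** Composing J with itself produces minus signs inside the arguments; oddness brings them out, so
    that the remaining values can serve as atoms of a linear problem. *)
Let odd3 (t : V -> V -> V -> R) := forall u v w,
  [/\ t (- u) v w = - t u v w, t u (- v) w = - t u v w & t u v (- w) = - t u v w].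

(** The conclusion says g((nabla_u J) v, w) = 0. For integrable J the Levi-Civita part contributes
    half of dF(Ju, Jv, w) + dF(Ju, v, Jw), and the two torsion terms contribute its opposite. *)
Lemma bismut_parallel (a n A t : V -> V -> V -> R) :
  odd3 a -> odd3 n ->
  (forall u v w, a u v w = a u w v) ->
  (forall u v w, A u v w = a u (J v) w + n u v w) ->
  (forall u v w, A u v w = - A u w v) ->
  nijenhuis_free n ->
  (forall u v w, t u v w =
     2^-1 * (a u v w + a v u w - a w u v + ext3 A (J u) (J v) (J w))) ->
  forall u v w, n u v w + t u (J v) w + t u v (J w) = 0.
Proof.
move=> aN nN a_sym AE A_skew nN0 tE u v w; rewrite !tE /ext3.
(* Once the signs are normalised, the goal is a linear combination of the instances collected from
   here on. Integrability is taken at [J u] because the torsion term evaluates dF on images of J. *)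
have := A_skew u v w; have := nN0 (J u) v w; have := A_skew (J u) (J v) w.
have := nN0 (J u) w v; rewrite !AE !(JK, JN).
rewrite !(fun u v w => let: And3 h _ _ := aN u v w in h).
rewrite !(fun u v w => let: And3 _ h _ := aN u v w in h).
rewrite !(fun u v w => let: And3 _ _ h := aN u v w in h).
rewrite !(fun u v w => let: And3 h _ _ := nN u v w in h).
rewrite !(fun u v w => let: And3 _ h _ := nN u v w in h).
rewrite !(fun u v w => let: And3 _ _ h := nN u v w in h).
have := a_sym u (J w) v; have := a_sym (J u) (J w) (J v); lra.
Qed.

(** With c(u, v, w) = t v w u - t w v u, both sides equal c(Ju, Jv, w) + c(Ju, v, Jw) + c(u, Jv,
    Jw). For dF this holds because F is parallel, so that dF is a cyclic sum of F(T(., .), .); for c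
    it is the vanishing of the Nijenhuis tensor written through the torsion. *)
Lemma skew_torsion_ext3 (a n A t : V -> V -> V -> R) :
  odd3 t ->
  (forall u v w, a u v w = t u v w + t u w v) ->
  (forall u v w, n u v w + t u (J v) w + t u v (J w) = 0) ->
  (forall u v w, A u v w = a u (J v) w + n u v w) ->
  nijenhuis_free n ->
  (forall u v w, t u w v - t w u v = - (t v w u - t w v u)) ->
  forall u v w, ext3 A (J u) (J v) (J w) = t v w u - t w v u.
Proof.
move=> tN aE nE AE nN0 c_skew u v w; rewrite /ext3 !AE !aE.
have nE' x y z : n x y z = - t x (J y) z - t x y (J z) by have := nE x y z; lra.
have := c_skew v (J u) (J w); have := c_skew (J u) w (J v).
have := nN0 (J v) w (J u); rewrite !nE' !(JK, JN).
rewrite !(fun u v w => let: And3 h _ _ := tN u v w in h).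
rewrite !(fun u v w => let: And3 _ h _ := tN u v w in h).
rewrite !(fun u v w => let: And3 _ _ h := tN u v w in h).
lra.
Qed.

End HermitianAlgebra.

(** * Tensor equations in a chart *)

Section ChartAlgebra.
Variables (R : realType) (n : nat).
Implicit Types (Gam : 'I_n -> 'M[R]_n) (u v w : 'cV[R]_n).

Definition chris Gam u v : 'cV[R]_n := \sum_(i < n) u i 0 *: (Gam i *m v).

Lemma chrisZl Gam c u v : chris Gam (c *: u) v = c *: chris Gam u v.
Proof.
by rewrite /chris scaler_sumr; apply: eq_bigr => i _ /=; rewrite mxE scalerA.
Qed.

Lemma chrisZr Gam c u v : chris Gam u (c *: v) = c *: chris Gam u v.
Proof.
rewrite /chris scaler_sumr; apply: eq_bigr => i _ /=.
by rewrite -scalemxAr !scalerA mulrC.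
Qed.

Lemma chrisNl Gam u v : chris Gam (- u) v = - chris Gam u v.
Proof. by rewrite -scaleN1r chrisZl scaleN1r. Qed.

Lemma chrisNr Gam u v : chris Gam u (- v) = - chris Gam u v.
Proof. by rewrite -scaleN1r chrisZr scaleN1r. Qed.

End ChartAlgebra.

Section PointwiseConditions.
Variables (R : realType) (n : nat) (M : smoothManifold R n).
Implicit Types (I : endoField M) (g : riemannianMetric M) (a : chart_index M).
Implicit Types (x u v w : 'cV[R]_n).

Lemma endo_differentiable I a x : chart_cod a x -> differentiable (I a) x.
Proof. by move=> ax; exact: smooth_on_differentiable (endo_smooth I a) ax. Qed.

Lemma metric_differentiable g a x : chart_cod a x -> differentiable (metric_mx g a) x.
Proof. by move=> ax; exact: smooth_on_differentiable (metric_smooth g a) ax. Qed.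

Lemma vector_field_differentiable a X x :
  vector_field a X -> chart_cod a x -> differentiable X x.
Proof. by move=> sX ax; exact: smooth_on_differentiable sX ax. Qed.

Lemma vector_field_cst a u : vector_field a (fun=> u).
Proof. exact: (smooth_on_cst (@chart_cod_open _ _ _ a)). Qed.

Lemma eq_derive_chart (W : normedModType R) (f h : 'cV[R]_n -> W) a x v :
  (forall y, chart_cod a y -> f y = h y) -> chart_cod a x -> 'D_v f x = 'D_v h x.
Proof.
move=> fh; apply: eq_derive_on; first exact: chart_cod_open.
by move=> y /set_mem; exact: fh.
Qed.

Definition kahler_mx I g a y : 'M[R]_n := (I a y)^T *m metric_mx g a y.

Lemma kahler_mx_smooth I g a : smooth_on (chart_cod a) (kahler_mx I g a).
Proof.
have ao := @chart_cod_open _ _ _ a.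
apply: (smooth_on_mulmx ao); last exact: metric_smooth.
by apply: (smooth_on_trmx ao); exact: endo_smooth.
Qed.

Lemma kahler_mx_differentiable I g a x :
  chart_cod a x -> differentiable (kahler_mx I g a) x.
Proof. by move=> ax; exact: smooth_on_differentiable (kahler_mx_smooth I g a) ax. Qed.

Lemma bilin_kahler_mx I g a x u v :
  bilin (kahler_mx I g a x) u v = g a x (I a x *m u) v.
Proof. exact: bilin_mull. Qed.

Definition metric_deriv g a x u v w : R := bilin ('D_u (metric_mx g a) x) v w.
Definition endo_deriv I g a x u v w : R := g a x ('D_u (I a) x *m v) w.
Definition kahler_deriv I g a x u v w : R := bilin ('D_u (kahler_mx I g a) x) v w.

Lemma kahler_derivE I g a x u v w : chart_cod a x ->
  kahler_deriv I g a x u v w =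
  metric_deriv g a x u (I a x *m v) w + endo_deriv I g a x u v w.
Proof.
move=> ax; have dI := endo_differentiable I ax.
rewrite /kahler_deriv /kahler_mx derive_mulmx //; last exact: metric_differentiable.
  by rewrite bilinD derive_trmx // !bilin_mull addrC.
exact: differentiable_trmx.
Qed.

Lemma metric_deriv_odd g a x u v w : chart_cod a x ->
  [/\ metric_deriv g a x (- u) v w = - metric_deriv g a x u v w,
      metric_deriv g a x u (- v) w = - metric_deriv g a x u v w &
      metric_deriv g a x u v (- w) = - metric_deriv g a x u v w].
Proof.
move=> ax; have DN := deriveNdir u (metric_differentiable g ax).
by split; rewrite /metric_deriv ?DN ?bilinN ?bilinNl ?bilinNr.
Qed.

Lemma endo_deriv_odd I g a x u v w : chart_cod a x ->
  [/\ endo_deriv I g a x (- u) v w = - endo_deriv I g a x u v w,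
      endo_deriv I g a x u (- v) w = - endo_deriv I g a x u v w &
      endo_deriv I g a x u v (- w) = - endo_deriv I g a x u v w].
Proof.
move=> ax; have DN := deriveNdir u (endo_differentiable I ax).
rewrite /endo_deriv /metric_at; split; last exact: bilinNr.
  by rewrite DN mulNmx bilinNl.
by rewrite mulmxN bilinNl.
Qed.

Lemma metric_deriv_sym g a x u v w : chart_cod a x ->
  metric_deriv g a x u v w = metric_deriv g a x u w v.
Proof.
move=> ax; have dg := metric_differentiable g ax.
rewrite /metric_deriv -!derive_bilin_cst //; apply: eq_derive_chart ax => y ay.
exact: Defs.metric_sym.
Qed.

Lemma hermitian_skew I g a x u v : almost_complex I -> Defs.hermitian I g ->
  chart_cod a x -> g a x (I a x *m u) v = - g a x u (I a x *m v).
Proof.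
move=> II Ig ax; rewrite (Ig a x ax) mulmxA (II a x ax).
by rewrite mulNmx mul1mx /metric_at bilinNl.
Qed.

Lemma kahler_mx_skew I g a x u v : almost_complex I -> Defs.hermitian I g ->
  chart_cod a x -> bilin (kahler_mx I g a x) u v = - bilin (kahler_mx I g a x) v u.
Proof.
move=> II Ig ax; rewrite !bilin_kahler_mx (hermitian_skew _ _ II Ig ax).
by congr (- _); exact: Defs.metric_sym.
Qed.

Lemma kahler_deriv_skew I g a x u v w : almost_complex I -> Defs.hermitian I g ->
  chart_cod a x -> kahler_deriv I g a x u v w = - kahler_deriv I g a x u w v.
Proof.
move=> II Ig ax; have dF := kahler_mx_differentiable I g ax.
rewrite /kahler_deriv -bilinNl -!derive_bilin_cst //.
apply: eq_derive_chart ax => y ay; rewrite bilinNl; exact: kahler_mx_skew.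
Qed.

Lemma endo_deriv_nijenhuis I g a x u v w : complex_structure I -> Defs.hermitian I g ->
  chart_cod a x ->
  endo_deriv I g a x (I a x *m u) v w - endo_deriv I g a x (I a x *m v) u w
  - endo_deriv I g a x v u (I a x *m w) + endo_deriv I g a x u v (I a x *m w) = 0.
Proof.
move=> [II NI] Ig ax; have dI := endo_differentiable I ax.
have := NI a _ _ (vector_field_cst a u) (vector_field_cst a v) x ax.
have Dendo p q : 'D_p (endo_app I a (fun=> q)) x = 'D_p (I a) x *m q.
  rewrite /endo_app (derive_mulmx p dI (differentiable_cst q x)).
  by rewrite derive_cst mulmx0 addr0.
rewrite /nijenhuis /lie_bracket /endo_app -!/(endo_app _ _ _) !Dendo !derive_cst.
have tidy (A : 'M[R]_n) (p q r s : 'cV[R]_n) :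
    p - q - A *m (0 - r) - A *m (s - 0) - (0 - 0) = p - q + A *m r - A *m s.
  by rewrite sub0r !subr0 mulmxN opprK.
rewrite tidy.
move=> N0; have : g a x 0 w = 0 by rewrite /metric_at -(scale0r 0) bilinZl mul0r.
rewrite -{1}N0 /metric_at !(bilinDl, bilinNl).
rewrite -!/(metric_at g a x _ _) !(hermitian_skew _ _ II Ig ax).
by rewrite /endo_deriv opprK.
Qed.

(** * Conditions on a connection as pointwise equations *)

Section Connection.
Variables (nabla : linearConnection M).

Lemma covariant_derivativeE a X Y x :
  nabla a X Y x = 'D_(X x) Y x + chris (christoffel nabla a x) (X x) (Y x).
Proof. by []. Qed.

Lemma torsionE a X Y x : torsion nabla a X Y x =
  chris (christoffel nabla a x) (X x) (Y x) - chris (christoffel nabla a x) (Y x) (X x).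
Proof.
rewrite /torsion !covariant_derivativeE /lie_bracket.
have cancel4 (p q c1 c2 : 'cV[R]_n) : p + c1 - (q + c2) - (p - q) = c1 - c2.
  by apply/matrixP => i j; rewrite !mxE; ring.
exact: cancel4.
Qed.

(** Constant fields suffice as tests: for general fields the Leibniz rule produces the same
    derivatives of [Y] and [Z] on both sides. *)
Lemma preserves_metricP g : preserves_metric nabla g <->
  forall a x u v w, chart_cod a x -> metric_deriv g a x u v w =
    g a x (chris (christoffel nabla a x) u v) w + g a x v (chris (christoffel nabla a x) u w).
Proof.
split=> [Hg a x u v w ax|Hg a X Y Z sX sY sZ x ax]; have dg := metric_differentiable g ax.
  have := Hg a _ _ _ (vector_field_cst a u) (vector_field_cst a v) (vector_field_cst a w) x ax.
  by rewrite derive_bilin_cst // !covariant_derivativeE !derive_cst !add0r.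
rewrite derive_bilin //; try exact: vector_field_differentiable ax.
rewrite -/(metric_deriv _ _ _ _ _ _) Hg // !covariant_derivativeE /metric_at.
rewrite bilinDl bilinDr.
have shuffle (c1 c2 d1 d2 : R) : c1 + c2 + d1 + d2 = d1 + c1 + (d2 + c2) by ring.
exact: shuffle.
Qed.

Lemma preserves_endoP I : preserves_endo nabla I <->
  forall a x u v, chart_cod a x ->
    'D_u (I a) x *m v + chris (christoffel nabla a x) u (I a x *m v) =
    I a x *m chris (christoffel nabla a x) u v.
Proof.
split=> [HI a x u v ax|HI a X Y sX sY x ax]; have dI := endo_differentiable I ax.
  have := HI a _ _ (vector_field_cst a u) (vector_field_cst a v) x ax.
  rewrite /endo_app !covariant_derivativeE (derive_mulmx u dI (differentiable_cst v x)).
  by rewrite !derive_cst mulmx0 addr0 add0r.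
have dY := vector_field_differentiable sY ax.
rewrite /endo_app !covariant_derivativeE derive_mulmx //.
by rewrite addrAC HI // mulmxDr addrC.
Qed.

Definition torsion_at g a x u v w : R :=
  g a x u (chris (christoffel nabla a x) v w - chris (christoffel nabla a x) w v).

(** By [torsionE] the torsion depends on the fields only through their values at the point, and the
    sign rule for its last two arguments is T(Y, Z) = - T(Z, Y). *)
Lemma skew_torsionP g : skew_torsion nabla g <->
  forall a x u v w, chart_cod a x -> torsion_at g a x v u w = - torsion_at g a x u v w.
Proof.
split=> [Hc a x u v w ax|Hc a X Y Z sX sY sZ x ax].
  have [+ _] := Hc a _ _ _ (vector_field_cst a u) (vector_field_cst a v)
    (vector_field_cst a w) x ax.
  by rewrite /torsion_form !torsionE.
rewrite /torsion_form !torsionE; split; first exact: Hc.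
by rewrite -opprB /metric_at bilinNr.
Qed.

End Connection.

End PointwiseConditions.

(** * Change of charts *)

Section ChartChange.
Variables (R : realType) (n : nat) (M : smoothManifold R n).
Implicit Types (I : endoField M) (g : riemannianMetric M) (a b : chart_index M).
Implicit Types (x u v w : 'cV[R]_n).

Lemma overlap_open a b : open (overlap a b).
Proof.
rewrite openE => x [ax bx]; apply: filterI.
  exact: (open_nbhs_nbhs (conj (@chart_cod_open _ _ _ a) ax)).
apply: (param_continuous ax).
exact: (open_nbhs_nbhs (conj (@chart_dom_open _ _ _ b) bx)).
Qed.

Lemma transition_overlap a b x : overlap a b x -> overlap b a (transition a b x).
Proof.
move=> [ax bx]; split; first exact: chart_in.
by rewrite /transition chartK //; exact: param_in.
Qed.

Lemma transitionK a b x : overlap a b x -> transition b a (transition a b x) = x.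
Proof. by move=> [ax bx]; rewrite /transition chartK // paramK. Qed.

Lemma transition_smooth_on a b : smooth_on (overlap a b) (transition a b).
Proof. exact: transition_smooth. Qed.

Lemma transition_differentiable a b x :
  overlap a b x -> differentiable (transition a b) x.
Proof. by move=> abx; exact: smooth_on_differentiable (@transition_smooth_on a b) abx. Qed.

(** The witness is the image of [w] under the derivative of the inverse transition. It allows an
    equation in chart b to be tested on vectors coming from chart a. *)
Lemma transition_surj a b x w : overlap a b x -> exists u, 'D_u (transition a b) x = w.
Proof.
move=> abx; have bay := transition_overlap abx.
exists ('D_w (transition b a) (transition a b x)).
have dba := transition_differentiable bay; have dab := transition_differentiable abx.
have dab' : differentiable (transition a b) (transition b a (transition a b x)).
  by rewrite transitionK.
have D := derive_comp w dba dab'.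
rewrite transitionK // in D; rewrite -D -[RHS](derive_id (transition a b x) w).
apply: (eq_derive_on (@overlap_open b a)) bay => y /set_mem bay.
exact: transitionK.
Qed.

Definition chart_second_deriv a b x u v : 'cV[R]_n :=
  'D_u (fun y => 'D_v (transition a b) y) x.

(** This symmetry of the Hessian is what makes dF a tensor and what leaves a single
    second-derivative term in the Koszul combination. *)
Lemma chart_second_derivC a b x u v : overlap a b x ->
  chart_second_deriv a b x u v = chart_second_deriv a b x v u.
Proof.
by move=> abx; exact: (derive_sym_mx (@overlap_open a b) v u (@transition_smooth_on a b) abx).
Qed.

Section Pullback.
Variable B : chart_index M -> 'cV[R]_n -> 'M[R]_n.
Hypothesis B_diff : forall a x, chart_cod a x -> differentiable (B a) x.
Hypothesis B_compat : forall a b x u v, overlap a b x ->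
  bilin (B b (transition a b x)) ('D_u (transition a b) x) ('D_v (transition a b) x) =
  bilin (B a x) u v.

(** Obtained by differentiating [B_compat] along [w]; the two Hessian terms come from the arguments,
    which vary with the base point. *)
Lemma derive_pullback a b x u v w : overlap a b x ->
  bilin ('D_w (B a) x) u v =
  bilin ('D_('D_w (transition a b) x) (B b) (transition a b x))
    ('D_u (transition a b) x) ('D_v (transition a b) x)
  + bilin (B b (transition a b x)) (chart_second_deriv a b x w u) ('D_v (transition a b) x)
  + bilin (B b (transition a b x)) ('D_u (transition a b) x) (chart_second_deriv a b x w v).
Proof.
move=> abx; have [ax _] := abx; have [bx _] := transition_overlap abx.
have dt := transition_differentiable abx.
have dBt : differentiable (B b \o transition a b) x.
  by apply: differentiable_comp => //; exact: B_diff.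
have dDt p : differentiable (fun y => 'D_p (transition a b) y) x.
  exact: smooth_on_differentiable (smooth_on_derive p (@transition_smooth_on a b)) abx.
rewrite -derive_bilin_cst; last exact: B_diff.
have E : 'D_w (fun y => bilin (B a y) u v : R^o) x =
    'D_w (fun y => bilin ((B b \o transition a b) y)
      ('D_u (transition a b) y) ('D_v (transition a b) y) : R^o) x.
  apply: (eq_derive_on (@overlap_open a b)) abx => y /set_mem aby.
  exact/esym/B_compat.
have DB := derive_comp w dt (B_diff bx).
apply: (etrans E); apply: (etrans (derive_bilin w dBt (dDt u) (dDt v))).
by rewrite DB.
Qed.

End Pullback.

Lemma metric_pullback g a b x u v : overlap a b x ->
  bilin (metric_mx g b (transition a b x)) ('D_u (transition a b) x) ('D_v (transition a b) x) =
  bilin (metric_mx g a x) u v.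
Proof.
by move=> abx; have dt := transition_differentiable abx; rewrite !deriveE // metric_compat.
Qed.

Lemma endo_pullback I a b x u : overlap a b x ->
  I b (transition a b x) *m 'D_u (transition a b) x = 'D_(I a x *m u) (transition a b) x.
Proof.
by move=> abx; have dt := transition_differentiable abx; rewrite !deriveE // endo_compat.
Qed.

Lemma kahler_pullback I g a b x u v : overlap a b x ->
  bilin (kahler_mx I g b (transition a b x)) ('D_u (transition a b) x) ('D_v (transition a b) x) =
  bilin (kahler_mx I g a x) u v.
Proof.
by move=> abx; rewrite !bilin_kahler_mx endo_pullback // /metric_at metric_pullback.
Qed.

Lemma metric_deriv_pullback g a b x u v w : overlap a b x ->
  metric_deriv g a x w u v =
  metric_deriv g b (transition a b x) ('D_w (transition a b) x)
    ('D_u (transition a b) x) ('D_v (transition a b) x)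
  + g b (transition a b x) (chart_second_deriv a b x w u) ('D_v (transition a b) x)
  + g b (transition a b x) (chart_second_deriv a b x w v) ('D_u (transition a b) x).
Proof.
move=> abx; have [bx _] := transition_overlap abx.
have P := derive_pullback (@metric_differentiable _ _ _ g) (@metric_pullback g) u v w abx.
by apply: (etrans P); congr (_ + _); exact: Defs.metric_sym.
Qed.

(** Each of the three derivatives brings two Hessian terms. Two pairs among the six cancel by
    symmetry of the Hessian, the third by skewness of the Kähler form. *)
Lemma kahler_ext_pullback I g a b x u v w :
  almost_complex I -> Defs.hermitian I g -> overlap a b x ->
  ext3 (kahler_deriv I g a x) u v w =
  ext3 (kahler_deriv I g b (transition a b x)) ('D_u (transition a b) x)
    ('D_v (transition a b) x) ('D_w (transition a b) x).
Proof.
have cancel (m1 m2 m3 d1 d2 d3 p q r s : R) :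
    m1 = d1 + p + r -> m2 = d2 + p + q -> m3 = d3 + s + q -> r = - s ->
    m1 - m2 + m3 = d1 - d2 + d3 by move=> -> -> -> ->; ring.
move=> II Ig abx; have [bx _] := transition_overlap abx.
have P p q r := derive_pullback (@kahler_mx_differentiable _ _ _ I g)
  (@kahler_pullback I g) p q r abx.
have skew p q := kahler_mx_skew p q II Ig bx.
have E : ext3 (kahler_deriv I g a x) u v w =
    bilin ('D_u (kahler_mx I g a) x) v w - bilin ('D_v (kahler_mx I g a) x) u w
    + bilin ('D_w (kahler_mx I g a) x) u v by [].
have Pv := P u w v; have Pw := P u v w.
rewrite (chart_second_derivC v u abx) in Pv.
rewrite (chart_second_derivC w u abx) (chart_second_derivC w v abx) in Pw.
apply: (etrans E); exact: cancel (P v w u) Pv Pw (skew _ _).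
Qed.

End ChartChange.

(** * The Bismut connection *)

Section Trilinear.
Variables (R : realType) (n : nat).
Implicit Types (t : 'cV[R]_n -> 'cV[R]_n -> 'cV[R]_n -> R).

Definition trilinear t : Prop :=
  [/\ forall c u u' v w, t (c *: u + u') v w = c * t u v w + t u' v w,
      forall c u v v' w, t u (c *: v + v') w = c * t u v w + t u v' w &
      forall c u v w w', t u v (c *: w + w') = c * t u v w + t u v w'].

Lemma linear_form0 (f : 'cV[R]_n -> R) :
  (forall c u u', f (c *: u + u') = c * f u + f u') -> f 0 = 0.
Proof. by move=> f_lin; have := f_lin (-1) 0 0; rewrite scaler0 addr0 => f0E; lra. Qed.

Lemma linear_formN (f : 'cV[R]_n -> R) (u : 'cV[R]_n) :
  (forall c u u', f (c *: u + u') = c * f u + f u') -> f (- u) = - f u.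
Proof.
move=> f_lin; have := f_lin (-1) u 0.
by rewrite (linear_form0 f_lin) !addr0 scaleN1r mulN1r.
Qed.

Lemma linear_sum_delta (f : 'cV[R]_n -> R) (u : 'cV[R]_n) :
  (forall c u u', f (c *: u + u') = c * f u + f u') ->
  f u = \sum_(i < n) u i 0 * f (delta_mx i 0).
Proof.
move=> f_lin; rewrite {1}(sum_delta_cV u).
by elim/big_rec2: _ => [|i y1 y2 _ <-]; [exact: linear_form0|rewrite f_lin].
Qed.

Lemma trilinearN t u v w : trilinear t -> t (- u) (- v) (- w) = - t u v w.
Proof.
move=> [t1 t2 t3].
rewrite (@linear_formN (fun u => t u _ _)) => [|c p q]; last exact: t1.
rewrite (@linear_formN (fun v => t _ v _)) => [|c p q]; last exact: t2.
rewrite (@linear_formN (fun w => t _ _ w)) => [|c p q]; last exact: t3.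
by rewrite opprK.
Qed.

Lemma trilinear_sum_delta t u v w : trilinear t ->
  t u v w = \sum_(i < n) \sum_(j < n) \sum_(k < n)
    u i 0 * v j 0 * w k 0 * t (delta_mx i 0) (delta_mx j 0) (delta_mx k 0).
Proof.
move=> [t1 t2 t3]; rewrite (@linear_sum_delta (fun u => t u v w)); last by move=> *; exact: t1.
apply: eq_bigr => i _.
rewrite (@linear_sum_delta (fun v => t _ v w)) => [|c u1 u2]; last exact: t2.
rewrite mulr_sumr; apply: eq_bigr => j _.
rewrite (@linear_sum_delta (fun w => t _ _ w)) => [|c u1 u2]; last exact: t3.
by rewrite !mulr_sumr; apply: eq_bigr => k _; rewrite !mulrA.
Qed.

Lemma trilinear_derive_bilin (B : 'cV[R]_n -> 'M[R]_n) x : differentiable B x ->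
  trilinear (fun u v w => bilin ('D_u B x) v w).
Proof.
move=> dB; split=> c *; last by rewrite bilinDr bilinZr.
  by rewrite (deriveDdir _ _ dB) (deriveZdir _ _ dB) bilinD bilinZ.
by rewrite bilinDl bilinZl.
Qed.

Lemma trilinear_ext3 t : trilinear t -> trilinear (ext3 t).
Proof. by move=> [t1 t2 t3]; split=> c *; rewrite /ext3 !(t1, t2, t3); ring. Qed.

Lemma trilinear_mulmx t (J : 'M[R]_n) : trilinear t ->
  trilinear (fun u v w => t (J *m u) (J *m v) (J *m w)).
Proof. by move=> [t1 t2 t3]; split=> c *; rewrite mulmxDr -scalemxAr. Qed.

Lemma trilinear_koszul t e : trilinear t -> trilinear e ->
  trilinear (fun u v w => 2^-1 * (t u v w + t v u w - t w u v + e u v w)).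
Proof.
by move=> [t1 t2 t3] [e1 e2 e3]; split=> c *; rewrite !(t1, t2, t3, e1, e2, e3); ring.
Qed.

End Trilinear.

Section BismutConnection.
Variables (R : realType) (n : nat) (M : smoothManifold R n).
Implicit Types (a b : chart_index M) (x u v w : 'cV[R]_n).
Variables (I : endoField M) (g : riemannianMetric M).

Definition bismut_torsion a x u v w : R :=
  ext3 (kahler_deriv I g a x) (I a x *m u) (I a x *m v) (I a x *m w).

(* The Koszul formula plus half the torsion: g(Gam(u, v), w) for the Christoffel
   symbols Gam of the metric connection with torsion form [bismut_torsion]. *)
Definition bismut_form a x u v w : R :=
  2^-1 * (metric_deriv g a x u v w + metric_deriv g a x v u w
          - metric_deriv g a x w u v + bismut_torsion a x u v w).

Lemma bismut_form_trilinear a x : chart_cod a x -> trilinear (bismut_form a x).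
Proof.
move=> ax.
exact: (trilinear_koszul
  (trilinear_derive_bilin (metric_differentiable g ax))
  (trilinear_mulmx (I a x)
    (trilinear_ext3 (trilinear_derive_bilin (kahler_mx_differentiable I g ax))))).
Qed.

(** Raising an index: the matrix on the right is g times the wanted symbol, because its (k, j) entry
    should be g(Gam(e_i, e_j), e_k). *)
Definition bismut_christoffel a x (i : 'I_n) : 'M[R]_n :=
  invmx (metric_mx g a x) *m
  \matrix_(k, j) bismut_form a x (delta_mx i 0) (delta_mx j 0) (delta_mx k 0).

Lemma metric_unitmx a x : chart_cod a x -> metric_mx g a x \in unitmx.
Proof. by move=> ax; apply: posdef_unitmx => u; exact: (metric_pos g ax). Qed.

Lemma bismut_christoffelE a x u v w : chart_cod a x ->
  g a x (chris (bismut_christoffel a x) u v) w = bismut_form a x u v w.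
Proof.
move=> ax; have uG := metric_unitmx ax.
rewrite (trilinear_sum_delta _ _ _ (bismut_form_trilinear ax)).
(* Symmetry puts the symbol to the right of the metric matrix, where its factor [invmx] cancels. *)
rewrite /metric_at (Defs.metric_sym g ax) /bilin /chris mulmx_sumr summxE.
apply: eq_bigr => i _; rewrite -scalemxAr mxE.
rewrite /bismut_christoffel -!mulmxA mulKVmx // mxE mulr_sumr exchange_big.
apply: eq_bigr => k _ /=; rewrite !mxE mulr_sumr.
rewrite mulr_sumr; apply: eq_bigr => j _; rewrite mxE.
set B := bismut_form _ _ _ _; clearbody B; ring.
Qed.

Lemma bismut_form_smooth a u v w : smooth_on (chart_cod a) (fun x => bismut_form a x u v w).
Proof.
have ao := @chart_cod_open _ _ _ a.
have scst p : smooth_on (chart_cod a) (fun=> p : 'cV[R]_n) by exact: smooth_on_cst.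
have smetric p q r : smooth_on (chart_cod a) (fun x => metric_deriv g a x p q r).
  exact: (smooth_on_bilin ao (smooth_on_derive p (metric_smooth g a)) (scst q) (scst r)).
have sI (p : 'cV[R]_n) : smooth_on (chart_cod a) (fun x => I a x *m p).
  exact: (smooth_on_mulmx ao (endo_smooth I a) (scst p)).
have skahler p q r : smooth_on (chart_cod a)
    (fun x => kahler_deriv I g a x (I a x *m p) (I a x *m q) (I a x *m r)).
  exact: (smooth_on_bilin ao (smooth_on_derive_along ao (kahler_mx_smooth I g a) (sI p))
    (sI q) (sI r)).
rewrite /bismut_form /bismut_torsion /ext3.
apply: smooth_onM => //; first exact: smooth_on_cst.
by do ![apply: smooth_onD => // | apply: smooth_onN => //].
Qed.

Lemma bismut_christoffel_smooth a i :
  smooth_on (chart_cod a) (fun x => bismut_christoffel a x i).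
Proof.
have ao := @chart_cod_open _ _ _ a.
apply: smooth_on_mulmx => //.
  by apply: smooth_on_invmx => //; [exact: metric_unitmx|exact: metric_smooth].
apply/smooth_on_mxP => // k j.
have := @bismut_form_smooth a (delta_mx i 0) (delta_mx j 0) (delta_mx k 0).
by apply: (eq_smooth_on ao) => x _; rewrite mxE.
Qed.

Hypothesis I_almost : almost_complex I.
Hypothesis I_herm : Defs.hermitian I g.

(** In the Koszul combination the Hessian terms for the pairs (u, w) and (v, w) cancel, while the
    one for (u, v) occurs twice and is halved by the factor 1/2. The torsion part is tensorial by
    [kahler_ext_pullback]. *)
Lemma bismut_form_pullback a b x u v w : overlap a b x ->
  bismut_form a x u v w =
  bismut_form b (transition a b x) ('D_u (transition a b) x) ('D_v (transition a b) x)
    ('D_w (transition a b) x)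
  + g b (transition a b x) (chart_second_deriv a b x u v) ('D_w (transition a b) x).
Proof.
have cancel (m1 m2 m3 e d1 d2 d3 f p q r : R) :
    m1 = d1 + p + q -> m2 = d2 + p + r -> m3 = d3 + q + r -> e = f ->
    2^-1 * (m1 + m2 - m3 + e) = 2^-1 * (d1 + d2 - d3 + f) + p.
  by move=> -> -> -> ->; lra.
move=> abx.
have P p q r := @metric_deriv_pullback _ _ _ g a b x q r p abx.
have Q : bismut_torsion a x u v w = bismut_torsion b (transition a b x)
    ('D_u (transition a b) x) ('D_v (transition a b) x) ('D_w (transition a b) x).
  have E p q r : I b (transition a b x) *m 'D_u (transition a b) x = p ->
      I b (transition a b x) *m 'D_v (transition a b) x = q ->
      I b (transition a b x) *m 'D_w (transition a b) x = r ->
      ext3 (kahler_deriv I g b (transition a b x)) p q r =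
      bismut_torsion b (transition a b x) ('D_u (transition a b) x)
        ('D_v (transition a b) x) ('D_w (transition a b) x) by move=> <- <- <-.
  apply: etrans (kahler_ext_pullback _ _ _ I_almost I_herm abx) _.
  by apply: E; exact: endo_pullback.
have Pv := P v u w; have Pw := P w u v.
rewrite (chart_second_derivC v u abx) in Pv.
rewrite (chart_second_derivC w u abx) (chart_second_derivC w v abx) in Pw.
exact: cancel (P u v w) Pv Pw Q.
Qed.

(** The classical law for Christoffel symbols. It follows from its lowered form by nondegeneracy of
    g in chart b, every test vector there being the image of one from chart a. *)
Lemma bismut_christoffel_pullback a b x u v : overlap a b x ->
  'D_(chris (bismut_christoffel a x) u v) (transition a b) x =
  chris (bismut_christoffel b (transition a b x)) ('D_u (transition a b) x)
    ('D_v (transition a b) x)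
  + chart_second_deriv a b x u v.
Proof.
move=> abx; have [ax _] := abx; have [bx _] := transition_overlap abx.
apply/eqP; rewrite -subr_eq0; apply/eqP.
apply: (bilin_eq0r (metric_unitmx bx)) => p.
have [w <-] := transition_surj p abx.
rewrite bilinDl bilinNl metric_pullback // bilinDl.
have E1 := bismut_christoffelE u v w ax.
have E2 := bismut_christoffelE ('D_u (transition a b) x) ('D_v (transition a b) x)
  ('D_w (transition a b) x) bx.
have E3 := bismut_form_pullback u v w abx.
rewrite -E2 -E1 /metric_at in E3.
by rewrite E3 opprD addrACA !subrr addr0.
Qed.

End BismutConnection.

(** * Gluing the Christoffel symbols into a connection *)

Section Connection.
Variables (R : realType) (n : nat) (M : smoothManifold R n).
Implicit Types (a b : chart_index M) (x u v w : 'cV[R]_n).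

(** Writes the derivative of the transition in a moving direction as a matrix product, to which the
    Leibniz rule applies. *)
Definition jacobian_mx a b x : 'M[R]_n :=
  \matrix_(i, j) ('D_(delta_mx j 0) (transition a b) x) i 0.

Lemma jacobian_mxE a b x u : overlap a b x ->
  jacobian_mx a b x *m u = 'D_u (transition a b) x.
Proof.
move=> /transition_differentiable dt; rewrite (derive_sum_delta _ dt).
apply/colP => i; rewrite mxE summxE; apply: eq_bigr => j _.
by rewrite !mxE mulrC.
Qed.

Lemma jacobian_mx_differentiable a b x : overlap a b x -> differentiable (jacobian_mx a b) x.
Proof.
move=> abx; apply/differentiable_mxP => i j; under eq_fun do rewrite mxE.
have s2 := smooth_on_derive (delta_mx j 0) (@transition_smooth_on _ _ _ a b).
exact: ((differentiable_mxP _ _).1 (smooth_on_differentiable s2 abx) i 0).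
Qed.

Lemma derive_pushforward a b (Y : 'cV[R]_n -> 'cV[R]_n) x u :
  overlap a b x -> differentiable Y x ->
  'D_u (fun y => 'D_(Y y) (transition a b) y) x =
  chart_second_deriv a b x u (Y x) + 'D_('D_u Y x) (transition a b) x.
Proof.
move=> abx dY; have dJ := jacobian_mx_differentiable abx.
have E : 'D_u (fun y => 'D_(Y y) (transition a b) y) x =
    'D_u (fun y => jacobian_mx a b y *m Y y) x.
  apply: (eq_derive_on (@overlap_open _ _ _ a b)) abx => y /set_mem aby.
  by rewrite jacobian_mxE.
have F : chart_second_deriv a b x u (Y x) = 'D_u (jacobian_mx a b) x *m Y x.
  have -> : 'D_u (jacobian_mx a b) x *m Y x = 'D_u (fun y => jacobian_mx a b y *m Y x) x.
    by rewrite (derive_mulmx u dJ (differentiable_cst (Y x) x)) derive_cst mulmx0 addr0.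
  apply: (eq_derive_on (@overlap_open _ _ _ a b)) abx => y /set_mem aby.
  by rewrite jacobian_mxE.
apply: (etrans E); rewrite (derive_mulmx u dJ dY).
by rewrite F jacobian_mxE.
Qed.

Variables (I : endoField M) (g : riemannianMetric M).
Hypothesis I_cplx : complex_structure I.
Hypothesis I_herm : Defs.hermitian I g.

(** Differentiating the pushed-forward field [Y'] along [X'] produces the Hessian at (X, Y), and the
    Christoffel law supplies the same term on the other side. *)
Lemma bismut_connection_compat a b (X Y X' Y' : 'cV[R]_n -> 'cV[R]_n) :
  smooth_on (overlap a b) X -> smooth_on (overlap a b) Y ->
  smooth_on (overlap b a) X' -> smooth_on (overlap b a) Y' ->
  same_field a b X X' -> same_field a b Y Y' ->
  same_field a b (covariant_derivative (bismut_christoffel I g a) X Y)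
                 (covariant_derivative (bismut_christoffel I g b) X' Y').
Proof.
move=> _ sY _ sY' XX' YY' x abx; have bay := transition_overlap abx.
have dt := transition_differentiable abx.
have dY := smooth_on_differentiable sY abx.
have dY' := smooth_on_differentiable sY' bay.
have X'E : X' (transition a b x) = 'D_(X x) (transition a b) x by rewrite deriveE // XX'.
have Y'E y : overlap a b y -> Y' (transition a b y) = 'D_(Y y) (transition a b) y.
  by move=> aby; rewrite deriveE ?YY' //; exact: transition_differentiable.
have D1 : 'D_(X x) (Y' \o transition a b) x =
    'D_(X x) (fun y => 'D_(Y y) (transition a b) y) x.
  by apply: (eq_derive_on (@overlap_open _ _ _ a b)) abx => y /set_mem aby; exact: Y'E.
have D2 : 'D_(X' (transition a b x)) Y' (transition a b x) =
    chart_second_deriv a b x (X x) (Y x) + 'D_('D_(X x) Y x) (transition a b) x.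
  rewrite X'E; apply: etrans (derive_pushforward (X x) abx dY).
  exact: etrans (esym (derive_comp (X x) dt dY')) D1.
have D3 := bismut_christoffel_pullback I_cplx.1 I_herm (X x) (Y x) abx.
rewrite -X'E -Y'E // in D3.
have D4 := deriveDdir ('D_(X x) Y x) (chris (bismut_christoffel I g a x) (X x) (Y x)) dt.
have D5 := etrans (esym (deriveE _ dt)) (etrans D4 (congr1 _ D3)).
apply: (etrans _ (esym D5)).
rewrite /covariant_derivative -/(chris _ _ _) D2.
have rearrange (p q r : 'cV[R]_n) : p + q + r = q + (r + p).
  by rewrite addrC addrA addrC addrCA.
exact: rearrange.
Qed.

Definition bismut_connection : linearConnection M :=
  LinearConnection (bismut_christoffel_smooth I g) bismut_connection_compat.

End Connection.

(** * Characterisation of HKT structures *)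

Section TorsionAlgebra.
Variables (R : realFieldType) (V : Type).
Implicit Types (a A t : V -> V -> V -> R).

Lemma ext3_swap12 A : (forall u v w, A u v w = - A u w v) ->
  forall u v w, ext3 A v u w = - ext3 A u v w.
Proof. by move=> sA u v w; rewrite /ext3 (sA w v u); ring. Qed.

Lemma ext3_swap23 A : (forall u v w, A u v w = - A u w v) ->
  forall u v w, ext3 A u w v = - ext3 A u v w.
Proof. by move=> sA u v w; rewrite /ext3 (sA u w v); ring. Qed.

(** Symmetrising the Koszul expression in its last two slots removes the skew [e] and the cross
    terms of [a]. *)
Lemma koszul_metric a e : (forall u v w, a u v w = a u w v) ->
  (forall u v w, e u w v = - e u v w) ->
  forall u v w, a u v w =
    2^-1 * (a u v w + a v u w - a w u v + e u v w) +
    2^-1 * (a u w v + a w u v - a v u w + e u w v).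
Proof. by move=> sa se u v w; rewrite se (sa u w v); lra. Qed.

(** Antisymmetrising in the first two slots removes [a] and doubles [e], which accounts for the
    factor 1/2. *)
Lemma koszul_torsion a e : (forall u v w, a u v w = a u w v) ->
  (forall u v w, e v u w = - e u v w) ->
  forall u v w,
    2^-1 * (a v w u + a w v u - a u v w + e v w u) -
    2^-1 * (a w v u + a v w u - a u w v + e w v u) = e v w u.
Proof. by move=> sa se u v w; rewrite (se v w) (sa u w v); lra. Qed.

End TorsionAlgebra.

Section BismutProperties.
Variables (R : realType) (n : nat) (M : smoothManifold R n).
Implicit Types (a : chart_index M) (x u v w : 'cV[R]_n).
Variables (g : riemannianMetric M).

Lemma endoK (I : endoField M) a x v : almost_complex I -> chart_cod a x ->
  I a x *m (I a x *m v) = - v.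
Proof. by move=> II ax; rewrite mulmxA II // mulNmx mul1mx. Qed.

Lemma metric_nondegenerate a x u v : chart_cod a x ->
  (forall w, g a x u w = g a x v w) -> u = v.
Proof.
move=> ax uv; apply/eqP; rewrite -subr_eq0; apply/eqP.
apply: (bilin_eq0r (metric_unitmx g ax)) => w.
by rewrite bilinDl bilinNl -!/(metric_at g a x _ _) uv subrr.
Qed.

(** The equation nabla I = 0 is lowered with g and the outer [I] is moved to [w] by skewness, which
    is the shape used in the pointwise Hermitian algebra. *)
Lemma preserves_endo_pointwise (nabla : linearConnection M) (I : endoField M) :
  almost_complex I -> Defs.hermitian I g ->
  preserves_endo nabla I <->
  forall a x u v w, chart_cod a x ->
    endo_deriv I g a x u v w
    + g a x (chris (christoffel nabla a x) u (I a x *m v)) w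
    + g a x (chris (christoffel nabla a x) u v) (I a x *m w) = 0.
Proof.
move=> II Ig; split=> [/preserves_endoP HI a x u v w ax|HI].
  have := HI a x u v ax => /(congr1 (fun z => g a x z w)) /=.
  rewrite (hermitian_skew _ _ II Ig ax) /metric_at bilinDl => ->.
  by rewrite addNr.
apply/preserves_endoP => a x u v ax; apply: (metric_nondegenerate ax) => w.
have /eqP := HI a x u v w ax; rewrite addr_eq0 => /eqP E.
by rewrite (hermitian_skew _ _ II Ig ax) -E /metric_at bilinDl.
Qed.

Section Parallel.
Variables (I : endoField M) (nabla : linearConnection M).
Hypothesis I_cplx : complex_structure I.
Hypothesis I_herm : Defs.hermitian I g.

(** The connection is left arbitrary so that a connection built from one complex structure can be
    tested against another with the same Bismut form. *)
Lemma bismut_preserves_endo :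
  (forall a x u v w, chart_cod a x ->
    g a x (chris (christoffel nabla a x) u v) w = bismut_form I g a x u v w) ->
  preserves_endo nabla I.
Proof.
move=> HG; have [II _] := I_cplx.
apply/(preserves_endo_pointwise nabla II I_herm) => a x u v w ax.
apply: (@bismut_parallel R _ (fun p => I a x *m p) _ (metric_deriv g a x)
  (endo_deriv I g a x) (kahler_deriv I g a x)
  (fun u v w => g a x (chris (christoffel nabla a x) u v) w)).
- by move=> p; exact: endoK.
- by move=> p q r; exact: metric_deriv_odd.
- by move=> p q r; exact: endo_deriv_odd.
- by move=> p q r; exact: metric_deriv_sym.
- by move=> p q r; exact: kahler_derivE.
- by move=> p q r; exact: kahler_deriv_skew.
- by move=> p q r; exact: endo_deriv_nijenhuis.
- by move=> p q r; exact: HG.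
Qed.

Lemma skew_torsion_bismut a x u v w :
  preserves_metric nabla g -> preserves_endo nabla I -> skew_torsion nabla g ->
  chart_cod a x -> torsion_at nabla g a x u v w = bismut_torsion I g a x u v w.
Proof.
move=> /preserves_metricP Hg HI /skew_torsionP Hc ax; have [II _] := I_cplx.
have {}HI := (preserves_endo_pointwise nabla II I_herm).1 HI.
pose t u v w : R := g a x (chris (christoffel nabla a x) u v) w.
have torsion_t p q r : torsion_at nabla g a x p q r = t q r p - t r q p.
  by rewrite /torsion_at /metric_at Defs.metric_sym // bilinDl bilinNl.
rewrite torsion_t; apply/esym.
apply: (@skew_torsion_ext3 R _ (fun p => I a x *m p) _ (metric_deriv g a x)
  (endo_deriv I g a x) (kahler_deriv I g a x) t).
- by move=> p; exact: endoK.
- move=> p q r; rewrite /t /metric_at; split.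
  + by rewrite chrisNl bilinNl.
  + by rewrite chrisNr bilinNl.
  + by rewrite bilinNr.
- move=> p q r; rewrite Hg //; congr (_ + _); exact: Defs.metric_sym.
- by move=> p q r; exact: HI.
- by move=> p q r; exact: kahler_derivE.
- by move=> p q r; exact: endo_deriv_nijenhuis.
- by move=> p q r; rewrite -!torsion_t; exact: Hc.
Qed.

End Parallel.

Section Bismut.
Variable I : endoField M.
Hypothesis I_cplx : complex_structure I.
Hypothesis I_herm : Defs.hermitian I g.
Let nabla := bismut_connection I_cplx I_herm.

Let nablaE a x u v w : chart_cod a x ->
  g a x (chris (christoffel nabla a x) u v) w = bismut_form I g a x u v w.
Proof. exact: bismut_christoffelE. Qed.

Let kahler_skew a x (ax : chart_cod a x) u v w :
  kahler_deriv I g a x u v w = - kahler_deriv I g a x u w v.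
Proof. by apply: kahler_deriv_skew => //; exact: I_cplx.1. Qed.

Lemma bismut_preserves_metric : preserves_metric nabla g.
Proof.
apply/preserves_metricP => a x u v w ax.
have E : g a x v (chris (christoffel nabla a x) u w) = bismut_form I g a x u w v.
  by rewrite -nablaE //; exact: Defs.metric_sym.
rewrite nablaE // E.
apply: koszul_metric => [p q r|p q r]; first exact: metric_deriv_sym.
exact: (ext3_swap23 (kahler_skew ax)).
Qed.

Lemma bismut_skew_torsion : skew_torsion nabla g.
Proof.
apply/skew_torsionP => a x u v w ax.
(* The lowered index of a Christoffel symbol sits in the last slot, hence the cyclic rotation; two
   adjacent transpositions of a 3-form undo it. *)
have E p q r : torsion_at nabla g a x p q r = bismut_torsion I g a x q r p.
  rewrite /torsion_at /metric_at Defs.metric_sym // bilinDl bilinNl -!/(metric_at g a x _ _).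
  rewrite !nablaE // /bismut_form; apply: (koszul_torsion (e := bismut_torsion I g a x)).
    by move=> *; exact: metric_deriv_sym.
  by move=> *; exact: (ext3_swap12 (kahler_skew ax)).
rewrite !E /bismut_torsion.
have s12 := ext3_swap12 (kahler_skew ax); have s23 := ext3_swap23 (kahler_skew ax).
by rewrite s12 s23 (s12 (I a x *m w)) (s23 (I a x *m w)) opprK.
Qed.

End Bismut.

Lemma preserves_endoM (nabla : linearConnection M) (I J K : endoField M) :
  (forall a x, chart_cod a x -> I a x = J a x *m K a x) ->
  preserves_endo nabla J -> preserves_endo nabla K -> preserves_endo nabla I.
Proof.
move=> IJK /preserves_endoP HJ /preserves_endoP HK; apply/preserves_endoP => a x u v ax.
have D : 'D_u (I a) x = 'D_u (J a) x *m K a x + J a x *m 'D_u (K a) x.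
  rewrite -derive_mulmx; [|exact: endo_differentiable..].
  by apply: eq_derive_chart ax => y; exact: IJK.
by rewrite D IJK // mulmxDl -!mulmxA -HK // mulmxDr addrAC HJ // addrC.
Qed.

End BismutProperties.

Section HKT.
Variables (R : realType) (n : nat) (M : smoothManifold R n).
Variables (I1 I2 I3 : endoField M) (g : riemannianMetric M).
Hypothesis hMIg : hyper_hermitian I1 I2 I3 g.
Implicit Types (a : chart_index M) (x u v w : 'cV[R]_n).

(** I2 I3 = I2 I1 I2 = - I3 I2 = - I1 I2 I2 = I1. *)
Lemma hypercomplex_mul23 a x : chart_cod a x -> I1 a x = I2 a x *m I3 a x.
Proof.
have [[[_ _] [II2 _] _ I12 I21] _] := hMIg => ax.
rewrite -(I12 a x ax) mulmxA (I21 a x ax) mulNmx -(I12 a x ax) -mulmxA (II2 a x ax).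
by rewrite mulmxN mulmx1 opprK.
Qed.

Lemma hkt_bismut_torsion : hkt_structure I1 I2 I3 g <->
  forall a x u v w, chart_cod a x ->
    bismut_torsion I2 g a x u v w = bismut_torsion I3 g a x u v w.
Proof.
have [[_ cI2 cI3 _ _] [_ hI2 hI3]] := hMIg.
split=> [[nabla [[Hg _ HI2 HI3] Hc]] a x u v w ax|E].
  rewrite -(skew_torsion_bismut cI2 hI2 u v w Hg HI2 Hc ax).
  by rewrite -(skew_torsion_bismut cI3 hI3 u v w Hg HI3 Hc ax).
exists (bismut_connection cI2 hI2).
have nablaE a x u v w : chart_cod a x ->
    g a x (chris (christoffel (bismut_connection cI2 hI2) a x) u v) w =
    bismut_form I2 g a x u v w.
  exact: bismut_christoffelE.
have P2 : preserves_endo (bismut_connection cI2 hI2) I2.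
  exact: (bismut_preserves_endo cI2 hI2 nablaE).
have P3 : preserves_endo (bismut_connection cI2 hI2) I3.
  apply: (bismut_preserves_endo cI3 hI3) => a x u v w ax.
  (* The metric terms of the two Bismut forms are literally the same; only the torsion terms have to
     be exchanged. *)
  by rewrite nablaE //; congr (_ * (_ + _)); exact: E.
split; last exact: bismut_skew_torsion.
split=> //; first exact: bismut_preserves_metric.
by apply: preserves_endoM P2 P3; exact: hypercomplex_mul23.
Qed.

Lemma hkt_kahler_ext : hkt_structure I1 I2 I3 g <->
  forall a x u v w, chart_cod a x ->
    ext3 (kahler_deriv I2 g a x) u v w =
    ext3 (kahler_deriv I3 g a x) (I1 a x *m u) (I1 a x *m v) (I1 a x *m w).
Proof.
have [[_ [II2 _] _ I12 I21] _] := hMIg.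
have I13 a x (ax : chart_cod a x) (p : 'cV[R]_n) : I3 a x *m p = I1 a x *m (I2 a x *m p).
  by rewrite mulmxA I12.
split=> [/hkt_bismut_torsion E|E].
  move=> a x u v w ax; have {}E p q r := E a x p q r ax.
  have I2K (p : 'cV[R]_n) : I2 a x *m (- (I2 a x *m p)) = p.
    by rewrite mulmxN (endoK _ II2 ax) opprK.
  (* I2 sends -I2 u to u, and I3 = I1 I2 sends it to I1 u. *)
  have := E (- (I2 a x *m u)) (- (I2 a x *m v)) (- (I2 a x *m w)).
  by rewrite /bismut_torsion !(I13 a x ax) !I2K.
apply/hkt_bismut_torsion => a x u v w ax.
by apply: etrans (E a x _ _ _ ax) _; rewrite -!I13.
Qed.

End HKT.

(** * The Dolbeault equations as real equations for dF_2 and dF_3 *)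

Section KahlerForms.
Variables (R : realType) (n : nat) (M : smoothManifold R n).
Variables (I1 I2 I3 : endoField M) (g : riemannianMetric M).
Hypothesis hMIg : hyper_hermitian I1 I2 I3 g.
Implicit Types (a : chart_index M) (x : 'cV[R]_n).

Lemma dR_kahler_form (I : endoField M) a x (v : 'I_3 -> 'cV[R]_n) :
  chart_cod a x -> dR (kahler_form I g) a x v =
  ext3 (kahler_deriv I g a x) (v ord0) (v (lift ord0 ord0)) (v ord_max).
Proof.
move=> ax; have dF := kahler_mx_differentiable I g ax.
have D p q r : 'D_p (fun y => g a y (I a y *m q) r : R^o) x = kahler_deriv I g a x p q r.
  rewrite /kahler_deriv -derive_bilin_cst //; apply: eq_derive_chart ax => y _.
  exact/esym/bilin_kahler_mx.
rewrite /dR /kahler_form !big_ord_recl big_ord0 addr0 !D.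
(* [lift i] skips the index i, so the remaining slots are (1, 2), (0, 2) and (0, 1), with signs +,
   -, +. *)
have e1 : lift ord0 (ord_max : 'I_2) = ord_max :> 'I_3 by exact: val_inj.
have e2 : lift ord0 (lift ord0 ord0) = ord_max :> 'I_3 by exact: val_inj.
have e3 : lift (lift ord0 ord0 : 'I_3) ord0 = ord0 by exact: val_inj.
have e4 : lift (lift ord0 ord0 : 'I_3) ord_max = ord_max by exact: val_inj.
have e5 : lift (ord_max : 'I_3) ord0 = ord0 by exact: val_inj.
have e6 : lift (ord_max : 'I_3) ord_max = lift ord0 ord0 by exact: val_inj.
rewrite e2 e1 e3 e4 e5 e6.
have sgn (p q r : R) : (-1) ^+ 0 * p + ((-1) ^+ 1 * q + (-1) ^+ 2 * r) = p - q + r by ring.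
exact: sgn.
Qed.

Lemma eq_dR k (f h : diff_form R M k) a x (v : 'I_k.+1 -> 'cV[R]_n) :
  (forall y (u : 'I_k -> 'cV[R]_n), chart_cod a y -> f a y u = h a y u) -> chart_cod a x ->
  dR f a x v = dR h a x v.
Proof.
move=> fh ax; apply: eq_bigr => i _; congr (_ * _).
by apply: eq_derive_chart ax => y ay; exact: fh.
Qed.

Lemma dR_opp k (f : diff_form R M k) a x (v : 'I_k.+1 -> 'cV[R]_n) :
  (forall u : 'I_k -> 'cV[R]_n, differentiable (fun y => f a y u : R^o) x) ->
  dR (fun b y u => - f b y u) a x v = - dR f a x v.
Proof.
move=> df; rewrite /dR -sumrN; apply: eq_bigr => i _; rewrite -mulrN; congr (_ * _).
by apply: deriveN; apply: diff_derivable.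
Qed.

Lemma dC_ReIm k (f h : diff_form R M k) (w : diff_form R[i] M k) a x
    (v : 'I_k.+1 -> 'cV[R]_n) :
  (forall y (u : 'I_k -> 'cV[R]_n), chart_cod a y -> w a y u = (f a y u +i* h a y u)%C) ->
  chart_cod a x ->
  dC w a x v = (dR f a x v +i* dR h a x v)%C.
Proof.
move=> wE ax; rewrite /dC; congr (_ +i* _)%C; apply: eq_dR => // y u ay; by rewrite wE.
Qed.

Lemma kahler_form_differentiable (I : endoField M) a x (u : 'I_2 -> 'cV[R]_n) :
  chart_cod a x -> differentiable (fun y => kahler_form I g a y u : R^o) x.
Proof.
move=> ax; have := (differentiable_mxP _ _).1 (differentiable_mulmx
  (differentiable_mulmx (differentiable_cst (u ord0)^T x) (kahler_mx_differentiable I g ax))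
  (differentiable_cst (u ord_max) x)) 0 0.
congr (differentiable _ _); apply/funext => y; exact: bilin_kahler_mx.
Qed.

(** I1 preserves g and anticommutes with I2 and I3. Thus [endo_form I1] acts as -1 on both forms,
    and [d_endo] of their complex combinations reduces to an ordinary d. *)
Lemma kahler_form_I1 a x (u : 'I_2 -> 'cV[R]_n) : chart_cod a x ->
  kahler_form I2 g a x (fun j => I1 a x *m u j) = - kahler_form I2 g a x u /\
  kahler_form I3 g a x (fun j => I1 a x *m u j) = - kahler_form I3 g a x u.
Proof.
have [[_ _ _ I12 I21] [h1 _ _]] := hMIg => ax; rewrite /kahler_form.
have I31 : I3 a x *m I1 a x = - (I1 a x *m I3 a x).
  by rewrite -(I12 a x ax) -mulmxA (I21 a x ax) mulmxN (I12 a x ax).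
rewrite !mulmxA (I21 a x ax) I31 -(I12 a x ax) !mulNmx -!mulmxA.
by rewrite /metric_at !bilinNl -!/(metric_at _ _ _ _ _) -!(h1 a x ax).
Qed.

(* The signs are those of [d_endo] and [endo_form] in degrees 2 and 3. *)
Lemma complex_del_eq0 (p q r s : R) (c : R[i]) : c != 0 ->
  c * ((p +i* q)%C + 'i%C * ((-1) ^+ 2 * ((-1) ^+ 3 * (r +i* s)%C))) = 0 <->
  p + s = 0 /\ q - r = 0.
Proof.
move=> c0.
have -> : ((p +i* q)%C + 'i%C * ((-1) ^+ 2 * ((-1) ^+ 3 * (r +i* s)%C)) : R[i]) =
    ((p + s) +i* (q - r))%C.
  by apply/eqP; rewrite eq_complex /=; simpc.
split=> [/eqP|[-> ->]]; last by rewrite mulr0.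
by rewrite mulf_eq0 (negPf c0) eq_complex /= => /andP[/eqP-> /eqP->].
Qed.

Lemma complex_delbar_eq0 (p q r s : R) (c : R[i]) : c != 0 ->
  c * ((p +i* q)%C - 'i%C * ((-1) ^+ 2 * ((-1) ^+ 3 * (r +i* s)%C))) = 0 <->
  p - s = 0 /\ q + r = 0.
Proof.
move=> c0.
have -> : ((p +i* q)%C - 'i%C * ((-1) ^+ 2 * ((-1) ^+ 3 * (r +i* s)%C)) : R[i]) =
    ((p - s) +i* (q + r))%C.
  by apply/eqP; rewrite eq_complex /=; simpc.
split=> [/eqP|[-> ->]]; last by rewrite mulr0.
by rewrite mulf_eq0 (negPf c0) eq_complex /= => /andP[/eqP-> /eqP->].
Qed.

(** The two equations are the real and the imaginary part; the factor i in front of [d_endo] pairs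
    dF_2 with dF_3. *)
Lemma del_kahler_eq0 a x (v : 'I_3 -> 'cV[R]_n) : chart_cod a x ->
  del I1 (form_addi (kahler_form I2 g) (kahler_form I3 g)) a x v = 0 <->
  dR (kahler_form I2 g) a x v = dR (kahler_form I3 g) a x (fun j => I1 a x *m v j) /\
  dR (kahler_form I3 g) a x v = - dR (kahler_form I2 g) a x (fun j => I1 a x *m v j).
Proof.
move=> ax; have dF I := kahler_form_differentiable I _ ax.
rewrite /del /d_endo /endo_form.
rewrite (dC_ReIm (f := kahler_form I2 g) (h := kahler_form I3 g)) //; last first.
  by move=> y u _; rewrite /form_addi; simpc.
rewrite (dC_ReIm (f := fun b y u => - kahler_form I2 g b y u)
                 (h := fun b y u => - kahler_form I3 g b y u)) //; last first.
  move=> y u ay; have [E2 E3] := kahler_form_I1 u ay.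
  by rewrite /form_addi E2 E3 sqrrN expr1n mul1r; simpc.
rewrite !dR_opp //.
rewrite complex_del_eq0 ?invr_eq0 ?pnatr_eq0 //.
split=> [[/eqP + /eqP]|[-> ->]]; last by rewrite opprK subrr addNr.
by rewrite subr_eq0 opprK addr_eq0 => /eqP-> /eqP->.
Qed.

(** Operator and form are the complex conjugates of those in [del_kahler_eq0], hence the same pair
    of real equations. *)
Lemma delbar_kahler_eq0 a x (v : 'I_3 -> 'cV[R]_n) : chart_cod a x ->
  delbar I1 (form_subi (kahler_form I2 g) (kahler_form I3 g)) a x v = 0 <->
  dR (kahler_form I2 g) a x v = dR (kahler_form I3 g) a x (fun j => I1 a x *m v j) /\
  dR (kahler_form I3 g) a x v = - dR (kahler_form I2 g) a x (fun j => I1 a x *m v j).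
Proof.
move=> ax; have dF I := kahler_form_differentiable I _ ax.
rewrite /delbar /d_endo /endo_form.
rewrite (dC_ReIm (f := kahler_form I2 g)
    (h := fun b y u => - kahler_form I3 g b y u)) //; last first.
  by move=> y u _; rewrite /form_subi; simpc.
rewrite (dC_ReIm (f := fun b y u => - kahler_form I2 g b y u)
    (h := kahler_form I3 g)) //; last first.
  move=> y u ay; have [E2 E3] := kahler_form_I1 u ay.
  by rewrite /form_subi E2 E3 sqrrN expr1n mul1r; simpc.
rewrite !dR_opp //.
rewrite complex_delbar_eq0 ?invr_eq0 ?pnatr_eq0 //.
split=> [[/eqP + /eqP]|[-> ->]]; last by rewrite opprK !subrr.
by rewrite subr_eq0 -opprD oppr_eq0 addr_eq0 => /eqP-> /eqP->.
Qed.

(** The imaginary part follows from the real one: replacing each argument by its image under I1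
    turns the right-hand side into dF_3(-u, -v, -w) = - dF_3(u, v, w). *)
Lemma kahler_ext_vanish :
  (forall a x (v : 'I_3 -> 'cV[R]_n), chart_cod a x ->
  dR (kahler_form I2 g) a x v = dR (kahler_form I3 g) a x (fun j => I1 a x *m v j) /\
  dR (kahler_form I3 g) a x v = - dR (kahler_form I2 g) a x (fun j => I1 a x *m v j)) <->
  (forall a x u v w, chart_cod a x ->
    ext3 (kahler_deriv I2 g a x) u v w =
    ext3 (kahler_deriv I3 g a x) (I1 a x *m u) (I1 a x *m v) (I1 a x *m w)).
Proof.
split=> H a x.
  move=> u v w ax; pose vec (i : 'I_3) := nth 0 [:: u; v; w] i.
  by have [+ _] := H a x vec ax; rewrite !dR_kahler_form.
move=> v ax; rewrite !dR_kahler_form //; split; first exact: H.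
have [[[II1 _] _ _ _ _] _] := hMIg.
have E := H a x (I1 a x *m v ord0) (I1 a x *m v (lift ord0 ord0)) (I1 a x *m v ord_max) ax.
rewrite !(endoK _ II1 ax) in E.
have N := trilinearN (v ord0) (v (lift ord0 ord0)) (v ord_max)
  (trilinear_ext3 (trilinear_derive_bilin (kahler_mx_differentiable I3 g ax))).
exact: canRL opprK (esym (etrans E N)).
Qed.

End KahlerForms.

Theorem proposition2 (R : realType) (n : nat) (M : smoothManifold R n)
    (I1 I2 I3 : endoField M) (g : riemannianMetric M)
    (hMIg : hyper_hermitian I1 I2 I3 g) :
  (hkt_structure I1 I2 I3 g <->
     form_vanishes (del I1 (form_addi (kahler_form I2 g) (kahler_form I3 g)))) /\
  (hkt_structure I1 I2 I3 g <->
     form_vanishes (delbar I1 (form_subi (kahler_form I2 g) (kahler_form I3 g)))).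
Proof.
have E := iff_trans (hkt_kahler_ext hMIg) (iff_sym (kahler_ext_vanish hMIg)).
split; apply: (iff_trans E); split=> H a x v ax.
- exact/(del_kahler_eq0 hMIg v ax)/H.
- exact/(del_kahler_eq0 hMIg v ax)/H.
- exact/(delbar_kahler_eq0 hMIg v ax)/H.
- exact/(delbar_kahler_eq0 hMIg v ax)/H.
Qed.
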